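(* Let $n\in\mathbb{N}$, let $T$ be a set of arithmetical sentences and let $\Gamma$ be a sequent. If $\Gamma$ is provable in $\mathsf{S}^{\Sigma}_n$ from assumptions $T$, then $\Gamma$ (i.e. the formula $\bigvee\Gamma$) is a theorem of $\mathsf{Q}+T+\Sigma_n\text{-}\mathsf{IR}$.
   Context: **Formulas and sequents.** Arithmetical terms are built from individual variables $\mathit{Var}=\{x_0,x_1,\dots\}$ and the constant $0$ by the unary symbol $s$ and the binary symbols $+,\cdot$. Arithmetical formulas are given by $\varphi::=t=t\mid t\neq t\mid(\varphi\wedge\varphi)\mid(\varphi\vee\varphi)\mid\forall y\,\varphi\mid\exists y\,\varphi$. Negation $\overline{\varphi}$ is the syntactic operation swapping $=$ with $\neq$, $\wedge$ with $\vee$, $\forall$ with $\exists$ (so $\overline{\overline\varphi}=\varphi$). Put $\bot:=0\neq 0$, $\varphi\to\psi:=\overline\varphi\vee\psi$. $x\leq y$ abbreviates $\exists z\,(z+x=y)$. $\varphi[y\mapsto t]$ is the substitution of $t$ for all free occurrences of $y$ (no variable of $t$ may become bound). A sequent is a finite multiset of formulas, interpreted as $\bigvee\Gamma$ (with $\bigvee\emptyset:=\bot$); the comma denotes multiset union. $\mathit{FV}$ denotes the set of free variables. **Classes.** Bounded quantifiers: $\forall y\leq t\,\varphi:=\forall y(y\leq t\to\varphi)$, $\exists y\leq t\,\varphi:=\exists y(y\leq t\wedge\varphi)$, with $y$ not in $t$. $\Delta_0=\Sigma_0=\Pi_0$ is the set of formulas built from atomic formulas by logical connectives and bounded quantifiers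 only. A formula is $\Sigma_{n+1}$ (resp. $\Pi_{n+1}$) if it is obtained from $\Pi_n$ (resp. $\Sigma_n$) formulas using existential (resp. universal) quantifiers and $\wedge,\vee$. **Theories.** Robinson's arithmetic $\mathsf{Q}$: first-order logic with equality plus (universal closures of) $\neg s(x)=0$; $s(x)=s(y)\to x=y$; $x=0\vee\exists y\,x=s(y)$; $x+0=x$; $x+s(y)=s(x+y)$; $x\cdot0=0$; $x\cdot s(y)=x\cdot y+x$. The induction rule $(\mathrm{IR})$: from $\varphi(0)$ and $\forall x(\varphi(x)\to\varphi(s(x)))$ infer $\forall x\,\varphi(x)$. For a theory $U$, $U+\Sigma_m\text{-}\mathsf{IR}$ is the closure of $U$ (under logical consequence and) under $(\mathrm{IR})$ for $\Sigma_m$ formulas $\varphi$. **Calculus $\mathsf{SQ}$.** Initial sequents: $\Gamma,t_0=t_1,t_0\neq t_1$ and $\Gamma,s(t)\neq0$. Rules (premisses / conclusion): $(\wedge)$: $\Gamma,\varphi$ and $\Gamma,\psi$ / $\Gamma,\varphi\wedge\psi$; $(\vee)$: $\Gamma,\varphi,\psi$ / $\Gamma,\varphi\vee\psi$; $(\forall)$: $\Gamma,\varphi[y\mapsto z]$ / $\Gamma,\forall y\,\varphi$, where $z\notin\mathit{FV}(\Gamma,\forall y\,\varphi)$ ($z$ is the active variable); $(\exists)$: $\Gamma,\varphi[y\mapsto t],\exists y\,\varphi$ / $\Gamma,\exists y\,\varphi$; $(\mathsf{ref})$: $\Gamma,t\neq t$ / $\Gamma$; $(\mathsf{rep})$: $\Gamma,t_0\neq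 t_1,(u_0\neq u_1)[y\mapsto t_0],(u_0\neq u_1)[y\mapsto t_1]$ / $\Gamma,t_0\neq t_1,(u_0\neq u_1)[y\mapsto t_0]$; $(\mathsf{add}_0)$: $\Gamma,t+0\neq t$ / $\Gamma$; $(\mathsf{add}_s)$: $\Gamma,t+s(u)\neq s(t+u)$ / $\Gamma$; $(\mathsf{mult}_0)$: $\Gamma,t\cdot0\neq0$ / $\Gamma$; $(\mathsf{mult}_s)$: $\Gamma,t\cdot s(u)\neq t\cdot u+t$ / $\Gamma$; $(\mathsf{pred})$: $\Gamma,s(t_0)\neq s(t_1),t_0\neq t_1$ / $\Gamma,s(t_0)\neq s(t_1)$; $(\mathsf{case})$: left premiss $\Gamma[y\mapsto0]$ and right premiss $\Gamma[y\mapsto s(y)]$ / $\Gamma$, where $y\in\mathit{FV}(\Gamma)$ ($y$ is the active variable); $(\mathsf{weak})$: $\Gamma$ / $\Gamma,\Delta$; $(\mathsf{cut})$: left premiss $\Gamma,\varphi$ and right premiss $\Gamma,\overline\varphi$ / $\Gamma$. **Proofs of $\mathsf{S}^{\Sigma}_n$ from assumptions.** An $\infty$-proof from assumptions $T$ is a possibly infinite tree whose nodes are marked by sequents, constructed according to the rules of $\mathsf{SQ}$, with every leaf marked by an initial sequent of $\mathsf{SQ}$ or by a sequent $\{\varphi\}$ with $\varphi\in T$, such that every infinite branch has a tail satisfying conditions (a)–(c) below. It is $\Sigma_n$-restricted if every infinite branch has a tail satisfying all of the following: (a) the tail does not pass through left premisses of $(\mathsf{case})$; (b) if the tail passes through the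 right premiss $\Gamma[z\mapsto s(z)]$ of $(\mathsf{case})$, then after that application the tail does not intersect applications of $(\forall)$ with active variable $z$; (c) for some variable $y$, the tail passes through the right premiss of $(\mathsf{case})$ with active variable $y$ infinitely many times; (d') if the tail passes through the left (right) premiss of $(\wedge)$, then $\varphi$ ($\psi$) is in $\Sigma_n$; (e') the tail does not intersect applications of $(\forall)$; (f') if the tail passes through the left (right) premiss of $(\mathsf{cut})$, then $\varphi$ ($\overline\varphi$) is in $\Sigma_n$; (g') if the tail passes through the right premiss $\Gamma[z\mapsto s(z)]$ of $(\mathsf{case})$, then $\Gamma$ consists entirely of $\Sigma_n$-formulas. Such a tree is regular if it contains only finitely many non-isomorphic subtrees with respect to the marking of sequents. A sequent $\Gamma$ is provable in $\mathsf{S}^{\Sigma}_n$ from assumptions $T$ if there is a $\Sigma_n$-restricted regular $\infty$-proof from $T$ with root marked by $\Gamma$. *)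

(* Defs.v *)
From Stdlib Require Export Bool Arith List Permutation.
Export ListNotations.

(** * Terms and formulas *)

(** Individual variables are named by natural numbers; formulas are raw named
    syntax and are not identified up to renaming of bound variables. *)
Definition var := nat.

Inductive term : Type :=
| Var (x : var)
| Zero
| Succ (t : term)
| Add (t u : term)
| Mul (t u : term).

Inductive formula : Type :=
| Eq (t u : term)
| Neq (t u : term)
| And (phi psi : formula)
| Or (phi psi : formula)
| All (y : var) (phi : formula)
| Ex (y : var) (phi : formula).

Fixpoint neg (phi : formula) : formula :=
  match phi with
  | Eq t u => Neq t u
  | Neq t u => Eq t u
  | And a b => Or (neg a) (neg b)
  | Or a b => And (neg a) (neg b)
  | All y a => Ex y (neg a)
  | Ex y a => All y (neg a)
  end.

Definition Bot : formula := Neq Zero Zero.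

Definition Imp (phi psi : formula) : formula := Or (neg phi) psi.

Fixpoint occurs (x : var) (t : term) : Prop :=
  match t with
  | Var y => x = y
  | Zero => False
  | Succ t => occurs x t
  | Add t u | Mul t u => occurs x t \/ occurs x u
  end.

Fixpoint free_in (x : var) (phi : formula) : Prop :=
  match phi with
  | Eq t u | Neq t u => occurs x t \/ occurs x u
  | And a b | Or a b => free_in x a \/ free_in x b
  | All y a | Ex y a => x <> y /\ free_in x a
  end.

Definition sentence (phi : formula) : Prop := forall x, ~ free_in x phi.

Fixpoint subst_term (y : var) (t : term) (u : term) : term :=
  match u with
  | Var x => if Nat.eqb x y then t else Var x
  | Zero => Zero
  | Succ u => Succ (subst_term y t u)
  | Add u v => Add (subst_term y t u) (subst_term y t v)
  | Mul u v => Mul (subst_term y t u) (subst_term y t v)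
  end.

(** [subst y t phi] is phi[y |-> t].  It does not rename bound variables, so it
    is the intended substitution only when [free_for t y phi] holds; this is
    always the case when [t] is [Zero] or [Succ (Var y)]. *)
Fixpoint subst (y : var) (t : term) (phi : formula) : formula :=
  match phi with
  | Eq u v => Eq (subst_term y t u) (subst_term y t v)
  | Neq u v => Neq (subst_term y t u) (subst_term y t v)
  | And a b => And (subst y t a) (subst y t b)
  | Or a b => Or (subst y t a) (subst y t b)
  | All x a => All x (if Nat.eqb x y then a else subst y t a)
  | Ex x a => Ex x (if Nat.eqb x y then a else subst y t a)
  end.

(** No variable of [t] becomes bound in phi[y |-> t]. *)
Fixpoint free_for (t : term) (y : var) (phi : formula) : Prop :=
  match phi with
  | Eq _ _ | Neq _ _ => True
  | And a b | Or a b => free_for t y a /\ free_for t y b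
  | All x a | Ex x a =>
      ~ (y <> x /\ free_in y a) \/ (~ occurs x t /\ free_for t y a)
  end.

(** * The arithmetical hierarchy *)

(** [Le z t u] is t <= u, with [z] the bound variable of the abbreviation. *)
Definition Le (z : var) (t u : term) : formula :=
  Ex z (Eq (Add (Var z) t) u).

Inductive delta0 : formula -> Prop :=
| delta0_eq t u : delta0 (Eq t u)
| delta0_neq t u : delta0 (Neq t u)
| delta0_and phi psi : delta0 phi -> delta0 psi -> delta0 (And phi psi)
| delta0_or phi psi : delta0 phi -> delta0 psi -> delta0 (Or phi psi)
| delta0_all y z t phi :
    ~ occurs y t -> z <> y -> ~ occurs z t ->
    delta0 phi -> delta0 (All y (Imp (Le z (Var y) t) phi))
| delta0_ex y z t phi :
    ~ occurs y t -> z <> y -> ~ occurs z t ->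
    delta0 phi -> delta0 (Ex y (And (Le z (Var y) t) phi)).

Inductive is_sigma : nat -> formula -> Prop :=
| sigma_delta0 phi : delta0 phi -> is_sigma 0 phi
| sigma_pi n phi : is_pi n phi -> is_sigma (S n) phi
| sigma_and n phi psi :
    is_sigma (S n) phi -> is_sigma (S n) psi -> is_sigma (S n) (And phi psi)
| sigma_or n phi psi :
    is_sigma (S n) phi -> is_sigma (S n) psi -> is_sigma (S n) (Or phi psi)
| sigma_ex n y phi : is_sigma (S n) phi -> is_sigma (S n) (Ex y phi)
with is_pi : nat -> formula -> Prop :=
| pi_delta0 phi : delta0 phi -> is_pi 0 phi
| pi_sigma n phi : is_sigma n phi -> is_pi (S n) phi
| pi_and n phi psi :
    is_pi (S n) phi -> is_pi (S n) psi -> is_pi (S n) (And phi psi)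
| pi_or n phi psi :
    is_pi (S n) phi -> is_pi (S n) psi -> is_pi (S n) (Or phi psi)
| pi_all n y phi : is_pi (S n) phi -> is_pi (S n) (All y phi).

(** * Theories *)

Definition boolean_valuation (v : formula -> bool) : Prop :=
  (forall phi, v (neg phi) = negb (v phi)) /\
  (forall phi psi, v (And phi psi) = v phi && v psi) /\
  (forall phi psi, v (Or phi psi) = v phi || v psi).

Definition tautology (phi : formula) : Prop :=
  forall v, boolean_valuation v -> v phi = true.

(** Hilbert-style axioms of classical first-order logic with equality.  The
    existential quantifier needs no axioms of its own, since
    [Ex y phi = neg (All y (neg phi))]. *)
Inductive logical_axiom : formula -> Prop :=
| ax_taut phi : tautology phi -> logical_axiom phi
| ax_inst y t phi :
    free_for t y phi -> logical_axiom (Imp (All y phi) (subst y t phi))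
| ax_dist y phi psi :
    ~ free_in y phi ->
    logical_axiom (Imp (All y (Imp phi psi)) (Imp phi (All y psi)))
| ax_refl t : logical_axiom (Eq t t)
| ax_leibniz y t u phi :
    free_for t y phi -> free_for u y phi ->
    logical_axiom (Imp (Eq t u) (Imp (subst y t phi) (subst y u phi))).

(** Theorems of U + Sigma_m-IR: the closure of [U] under derivability in
    first-order logic with equality and under the induction rule for Sigma_m
    formulas, which may contain parameters. *)
Inductive theorem_IR (U : formula -> Prop) (m : nat) : formula -> Prop :=
| th_axiom phi : U phi -> theorem_IR U m phi
| th_logic phi : logical_axiom phi -> theorem_IR U m phi
| th_mp phi psi :
    theorem_IR U m phi -> theorem_IR U m (Imp phi psi) -> theorem_IR U m psi
| th_gen y phi : theorem_IR U m phi -> theorem_IR U m (All y phi)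
| th_IR x phi :
    is_sigma m phi ->
    theorem_IR U m (subst x Zero phi) ->
    theorem_IR U m (All x (Imp phi (subst x (Succ (Var x)) phi))) ->
    theorem_IR U m (All x phi).

Inductive Q_axiom : formula -> Prop :=
| Q_succ_nonzero : Q_axiom (All 0 (neg (Eq (Succ (Var 0)) Zero)))
| Q_succ_inj :
    Q_axiom (All 0 (All 1 (Imp (Eq (Succ (Var 0)) (Succ (Var 1)))
                               (Eq (Var 0) (Var 1)))))
| Q_pred :
    Q_axiom (All 0 (Or (Eq (Var 0) Zero) (Ex 1 (Eq (Var 0) (Succ (Var 1))))))
| Q_add_zero : Q_axiom (All 0 (Eq (Add (Var 0) Zero) (Var 0)))
| Q_add_succ :
    Q_axiom (All 0 (All 1 (Eq (Add (Var 0) (Succ (Var 1)))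
                              (Succ (Add (Var 0) (Var 1))))))
| Q_mul_zero : Q_axiom (All 0 (Eq (Mul (Var 0) Zero) Zero))
| Q_mul_succ :
    Q_axiom (All 0 (All 1 (Eq (Mul (Var 0) (Succ (Var 1)))
                              (Add (Mul (Var 0) (Var 1)) (Var 0))))).

(** * The calculus SQ *)

(** Finite multisets of formulas are lists considered up to [Permutation]. *)
Definition sequent := list formula.

Fixpoint bigor (G : sequent) : formula :=
  match G with
  | [] => Bot
  | [phi] => phi
  | phi :: G' => Or phi (bigor G')
  end.

Definition free_in_seq (x : var) (G : sequent) : Prop := Exists (free_in x) G.

(** The name of the rule applied at a node, with the data identifying its
    principal, cut or instantiated formulas and its active variable. *)
Inductive rule : Type :=
| RInit
| RAssumption
| RAnd (phi psi : formula)
| ROr (phi psi : formula)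
| RAll (y : var) (phi : formula) (z : var)
| REx (y : var) (phi : formula) (t : term)
| RRef
| RRep
| RAdd0
| RAddS
| RMult0
| RMultS
| RPred
| RCase (y : var)
| RWeak
| RCut (phi : formula).

(** [inference T r G Ps]: [r] derives [G] from the premisses [Ps], listed from
    left to right. *)
Inductive inference (T : formula -> Prop) :
  rule -> sequent -> list sequent -> Prop :=
| inf_init_eq G t0 t1 : inference T RInit (Eq t0 t1 :: Neq t0 t1 :: G) []
| inf_init_succ G t : inference T RInit (Neq (Succ t) Zero :: G) []
| inf_assumption phi : T phi -> inference T RAssumption [phi] []
| inf_and G phi psi :
    inference T (RAnd phi psi) (And phi psi :: G) [phi :: G; psi :: G]
| inf_or G phi psi :
    inference T (ROr phi psi) (Or phi psi :: G) [phi :: psi :: G]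
| inf_all G y phi z :
    free_for (Var z) y phi ->
    ~ free_in_seq z (All y phi :: G) ->
    inference T (RAll y phi z) (All y phi :: G) [subst y (Var z) phi :: G]
| inf_ex G y phi t :
    free_for t y phi ->
    inference T (REx y phi t) (Ex y phi :: G)
      [subst y t phi :: Ex y phi :: G]
| inf_ref G t : inference T RRef G [Neq t t :: G]
| inf_rep G y t0 t1 u0 u1 :
    inference T RRep
      (Neq t0 t1 :: subst y t0 (Neq u0 u1) :: G)
      [Neq t0 t1 :: subst y t0 (Neq u0 u1) :: subst y t1 (Neq u0 u1) :: G]
| inf_add0 G t : inference T RAdd0 G [Neq (Add t Zero) t :: G]
| inf_addS G t u :
    inference T RAddS G [Neq (Add t (Succ u)) (Succ (Add t u)) :: G]
| inf_mult0 G t : inference T RMult0 G [Neq (Mul t Zero) Zero :: G]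
| inf_multS G t u :
    inference T RMultS G [Neq (Mul t (Succ u)) (Add (Mul t u) t) :: G]
| inf_pred G t0 t1 :
    inference T RPred (Neq (Succ t0) (Succ t1) :: G)
      [Neq (Succ t0) (Succ t1) :: Neq t0 t1 :: G]
| inf_case G y :
    free_in_seq y G ->
    inference T (RCase y) G
      [map (subst y Zero) G; map (subst y (Succ (Var y))) G]
| inf_weak G D : inference T RWeak (G ++ D) [G]
| inf_cut G phi : inference T (RCut phi) G [phi :: G; neg phi :: G].

(** * Infinite proofs *)

(** A node is addressed by the list of child indices on the path leading to it
    from the root, child [0] being the left (or only) premiss and child [1] the
    right one; [mark] is [None] outside the tree. *)
Definition address := list nat.

Record marked_tree : Type := MarkedTree {
  mark : address -> option sequent;
  rule_at : address -> rule
}.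

Definition same_mark (m m' : option sequent) : Prop :=
  match m, m' with
  | Some G, Some G' => Permutation G G'
  | None, None => True
  | _, _ => False
  end.

(** [rule_at] is only meaningful on the nodes of the tree.  Leaves are exactly
    the nodes carrying [RInit] or [RAssumption], the rules without premisses. *)
Definition built_by_rules (T : formula -> Prop) (P : marked_tree) : Prop :=
  (exists G, mark P [] = Some G) /\
  (forall a i, mark P a = None -> mark P (a ++ [i]) = None) /\
  (forall a G, mark P a = Some G ->
     exists G' Ps,
       Permutation G G' /\ inference T (rule_at P a) G' Ps /\
       forall i, same_mark (mark P (a ++ [i])) (nth_error Ps i)).

(** The [k]-th node of the branch that takes child [b j] at its [j]-th node. *)
Definition node (b : nat -> nat) (k : nat) : address := map b (seq 0 k).

Definition infinite_branch (P : marked_tree) (b : nat -> nat) : Prop :=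
  forall k, mark P (node b k) <> None.

(** In the following conditions the tail of the branch [b] is the one starting
    at its [N]-th node. *)
Definition through_left (P : marked_tree) (b : nat -> nat) (N : nat)
    (r : rule) (k : nat) : Prop :=
  N <= k /\ rule_at P (node b k) = r /\ b k = 0.

Definition through_right (P : marked_tree) (b : nat -> nat) (N : nat)
    (r : rule) (k : nat) : Prop :=
  N <= k /\ rule_at P (node b k) = r /\ b k = 1.

Definition cond_a (P : marked_tree) (b : nat -> nat) (N : nat) : Prop :=
  forall y k, ~ through_left P b N (RCase y) k.

Definition cond_b (P : marked_tree) (b : nat -> nat) (N : nat) : Prop :=
  forall z k, through_right P b N (RCase z) k ->
    forall j y phi, k < j -> rule_at P (node b j) <> RAll y phi z.

Definition cond_c (P : marked_tree) (b : nat -> nat) (N : nat) : Prop :=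
  exists y, forall m, exists k, m <= k /\ through_right P b N (RCase y) k.

Definition cond_d (P : marked_tree) (b : nat -> nat) (N : nat)
    (n : nat) : Prop :=
  forall phi psi k,
    (through_left P b N (RAnd phi psi) k -> is_sigma n phi) /\
    (through_right P b N (RAnd phi psi) k -> is_sigma n psi).

Definition cond_e (P : marked_tree) (b : nat -> nat) (N : nat) : Prop :=
  forall y phi z k, N <= k -> rule_at P (node b k) <> RAll y phi z.

Definition cond_f (P : marked_tree) (b : nat -> nat) (N : nat)
    (n : nat) : Prop :=
  forall phi k,
    (through_left P b N (RCut phi) k -> is_sigma n phi) /\
    (through_right P b N (RCut phi) k -> is_sigma n (neg phi)).

Definition cond_g (P : marked_tree) (b : nat -> nat) (N : nat)
    (n : nat) : Prop :=
  forall z k G, through_right P b N (RCase z) k ->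
    mark P (node b k) = Some G -> Forall (is_sigma n) G.

Definition infinitary_proof (T : formula -> Prop) (P : marked_tree) : Prop :=
  built_by_rules T P /\
  forall b, infinite_branch P b ->
    exists N, cond_a P b N /\ cond_b P b N /\ cond_c P b N.

Definition sigma_restricted (n : nat) (P : marked_tree) : Prop :=
  forall b, infinite_branch P b ->
    exists N,
      cond_a P b N /\ cond_b P b N /\ cond_c P b N /\
      cond_d P b N n /\ cond_e P b N /\ cond_f P b N n /\ cond_g P b N n.

(** The subtrees at [a] and [a'] are isomorphic with respect to the marking of
    sequents, as trees with ordered children. *)
Definition isomorphic_subtrees (P : marked_tree) (a a' : address) : Prop :=
  forall c, same_mark (mark P (a ++ c)) (mark P (a' ++ c)).

Definition regular (P : marked_tree) : Prop :=
  exists L : list address,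
    forall a, mark P a <> None ->
      exists a', In a' L /\ isomorphic_subtrees P a a'.

Definition provable_S (n : nat) (T : formula -> Prop) (G : sequent) : Prop :=
  exists P,
    infinitary_proof T P /\ sigma_restricted n P /\ regular P /\
    same_mark (mark P []) (Some G).

(* Main.v *)
Require Import Defs.
From Stdlib Require Import Lia Classical ClassicalEpsilon ProofIrrelevance Cantor Ring.
From Stdlib Require Import PropExtensionality FunctionalExtensionality.

(** By completeness of first-order logic it suffices to work in models of the
    theorems of Q + T + Sigma_n-IR. If the root is not valid in these models,
    take a terminal strongly connected component of the finite graph of
    non-valid nodes up to isomorphism. Every edge of this component lies on a
    periodic branch, so the component contains no (forall), no left premiss of
    (case), only Sigma_n sequents at applications of (case), and every infinite
    path in it meets (case). Hence from an assignment refuting the conjunction A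
    of the (case) sequents of the component we get another one by decreasing one
    of finitely many variables by 1. As A is Sigma_n, this yields the validity
    of A, a contradiction.

    The last step uses Sigma_n-IR only. Several variables are merged into one by
    a pairing function, and course-of-values induction on one variable y is
    induction on j for "there is a common bound of the witnesses of A for all
    y <= j". This is Sigma_n up to equivalence, because Sigma_n-IR proves
    induction, hence collection, for the lower levels of the hierarchy. *)

(** * Semantics *)

(** Induction is available as a rule, not as a scheme: its premisses must be theorems, so an
    assumption that holds in one model only cannot be used. All arguments are therefore made for all
    models at once. An assumption needed during an induction has to be written into the induction
    formula, at the price of one level of the hierarchy. Collection is thus obtained only below
    level n, whereas the final induction, whose progressiveness holds in every model, works at level
    n itself.

    A single branch would not suffice to reach a contradiction, because the branch along which a
    refutation travels depends on the model and the assignment. In a terminal component every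
    refuted premiss stays inside, so the restriction on branches governs each possible continuation.

    The variable that decreases may change from step to step while the others keep their values.
    Nested inductions would quantify universally over the inner variables, and such statements need
    not be Sigma_n; a pairing function keeps the complexity unchanged. *)

Record structure : Type := Structure {
  dom :> Set;
  zero : dom;
  succ : dom -> dom;
  add : dom -> dom -> dom;
  mul : dom -> dom -> dom
}.
Arguments zero {_}.
Arguments succ {_}.
Arguments add {_}.
Arguments mul {_}.

Definition upd {A : Type} (rho : var -> A) (y : var) (d : A) : var -> A :=
  fun x => if Nat.eqb x y then d else rho x.

Fixpoint eval (M : structure) (rho : var -> M) (t : term) : M :=
  match t with
  | Var x => rho x
  | Zero => zero
  | Succ t => succ (eval M rho t)
  | Add t u => add (eval M rho t) (eval M rho u)
  | Mul t u => mul (eval M rho t) (eval M rho u)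
  end.

Fixpoint sat (M : structure) (rho : var -> M) (phi : formula) : Prop :=
  match phi with
  | Eq t u => eval M rho t = eval M rho u
  | Neq t u => eval M rho t <> eval M rho u
  | And a b => sat M rho a /\ sat M rho b
  | Or a b => sat M rho a \/ sat M rho b
  | All y a => forall d, sat M (upd rho y d) a
  | Ex y a => exists d, sat M (upd rho y d) a
  end.

Lemma upd_same {A} (rho : var -> A) y d : upd rho y d y = d.
Proof. unfold upd; now rewrite Nat.eqb_refl. Qed.

Lemma upd_other {A} (rho : var -> A) x y d : x <> y -> upd rho y d x = rho x.
Proof. intro H; unfold upd; now apply Nat.eqb_neq in H as ->. Qed.

Lemma eval_ext M rho rho' t :
  (forall x, occurs x t -> rho x = rho' x) -> eval M rho t = eval M rho' t.
Proof.
  induction t; simpl; intro H; auto; f_equal; auto.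
Qed.

Lemma sat_ext M phi : forall rho rho',
  (forall x, free_in x phi -> rho x = rho' x) ->
  sat M rho phi <-> sat M rho' phi.
Proof.
  induction phi; simpl; intros rho rho' H.
  1,2: rewrite (eval_ext M rho rho' t), (eval_ext M rho rho' u); auto; tauto.
  1,2: rewrite (IHphi1 rho rho'), (IHphi2 rho rho'); auto; tauto.
  all: assert (E : forall d, sat M (upd rho y d) phi <-> sat M (upd rho' y d) phi)
    by (intro d; apply IHphi; intros x Hx; unfold upd;
        destruct (Nat.eqb_spec x y); auto).
  - split; intros K d; apply E; auto.
  - split; intros [d K]; exists d; apply E; auto.
Qed.

Lemma eval_subst M rho y t u :
  eval M rho (subst_term y t u) = eval M (upd rho y (eval M rho t)) u.
Proof.
  induction u; simpl; try congruence.
  unfold upd; now destruct (Nat.eqb x y).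
Qed.

Lemma occurs_subst_absent y t u : ~ occurs y u -> subst_term y t u = u.
Proof.
  induction u; simpl; intro H; auto.
  - destruct (Nat.eqb_spec x y); subst; tauto.
  - now rewrite IHu.
  - rewrite IHu1, IHu2; tauto.
  - rewrite IHu1, IHu2; tauto.
Qed.

Lemma subst_not_free y t phi : ~ free_in y phi -> subst y t phi = phi.
Proof.
  induction phi; simpl; intro H.
  1,2: rewrite !occurs_subst_absent; tauto.
  1,2: rewrite IHphi1, IHphi2; tauto.
  1,2: destruct (Nat.eqb_spec y0 y); [easy|]; rewrite IHphi; intuition.
Qed.

Lemma sat_subst M phi : forall rho y t,
  free_for t y phi ->
  sat M rho (subst y t phi) <-> sat M (upd rho y (eval M rho t)) phi.
Proof.
  assert (Q : forall a y0 rho y t,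
    (forall rho, free_for t y a ->
       sat M rho (subst y t a) <-> sat M (upd rho y (eval M rho t)) a) ->
    (~ (y <> y0 /\ free_in y a) \/ (~ occurs y0 t /\ free_for t y a)) ->
    forall d, sat M (upd rho y0 d) (if Nat.eqb y0 y then a else subst y t a) <->
              sat M (upd (upd rho y (eval M rho t)) y0 d) a).
  { intros a y0 rho y t IH H d.
    destruct (Nat.eqb_spec y0 y) as [->|N].
    - apply sat_ext; intros x _; unfold upd; now destruct (Nat.eqb x y).
    - destruct H as [H|[H1 H2]].
      + rewrite subst_not_free by intuition.
        apply sat_ext; intros x Hx. unfold upd.
        destruct (Nat.eqb_spec x y0); auto.
        destruct (Nat.eqb_spec x y); auto; subst; intuition.
      + rewrite IH by auto. apply sat_ext; intros x Hx.
        assert (E : eval M (upd rho y0 d) t = eval M rho t).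
        { apply eval_ext; intros z Hz; apply upd_other; congruence. }
        rewrite E. unfold upd.
        destruct (Nat.eqb_spec x y0), (Nat.eqb_spec x y); auto; subst; congruence. }
  induction phi; simpl; intros rho y' t' H.
  1,2: rewrite !eval_subst; tauto.
  1,2: rewrite IHphi1, IHphi2; tauto.
  1,2: pose proof (Q phi y rho y' t' (fun r => IHphi r y' t') H) as E.
  - split; intros K d; apply E; auto.
  - split; intros [d K]; exists d; apply E; auto.
Qed.

Lemma neg_involutive phi : neg (neg phi) = phi.
Proof. induction phi; simpl; congruence. Qed.

Lemma sat_neg M phi : forall rho, sat M rho (neg phi) <-> ~ sat M rho phi.
Proof.
  induction phi; simpl; intro rho.
  - tauto.
  - split; [tauto|apply NNPP].
  - rewrite IHphi1, IHphi2; tauto.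
  - rewrite IHphi1, IHphi2; tauto.
  - split.
    + intros [d H] K; exact (proj1 (IHphi _) H (K d)).
    + intro H; apply not_all_ex_not in H as [d H]; exists d; now apply IHphi.
  - split.
    + intros H [d K]; exact (proj1 (IHphi _) (H d) K).
    + intros H d; apply IHphi; intro K; apply H; eauto.
Qed.

Lemma sat_imp M rho phi psi :
  sat M rho (Imp phi psi) <-> (sat M rho phi -> sat M rho psi).
Proof. simpl; rewrite sat_neg; tauto. Qed.

Lemma free_for_closed t y phi : (forall x, ~ occurs x t) -> free_for t y phi.
Proof. intro H; induction phi; simpl; auto. Qed.

(** Covers [Succ (Var y)]: a quantifier over [y] itself stops the substitution, and no other
    quantifier can capture anything. *)
Lemma free_for_own t y phi : (forall x, occurs x t -> x = y) -> free_for t y phi.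
Proof.
  intro H; induction phi; simpl; auto.
  all: destruct (Nat.eq_dec y y0); [left; tauto|right; split; auto; intro K; apply H in K; congruence].
Qed.

(** * Fresh variables and renaming *)

Fixpoint term_bound (t : term) : nat :=
  match t with
  | Var x => S x
  | Zero => 0
  | Succ t => term_bound t
  | Add t u | Mul t u => Nat.max (term_bound t) (term_bound u)
  end.

Fixpoint bound (phi : formula) : nat :=
  match phi with
  | Eq t u | Neq t u => Nat.max (term_bound t) (term_bound u)
  | And a b | Or a b => Nat.max (bound a) (bound b)
  | All y a | Ex y a => Nat.max (bound a) (S y)
  end.

Lemma occurs_bound x t : occurs x t -> x < term_bound t.
Proof. 
  induction t; simpl; intro H; [lia|easy|auto| |].
  all: destruct H as [H|H]; [apply IHt1 in H|apply IHt2 in H]; lia.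
Qed.

Lemma free_bound x phi : free_in x phi -> x < bound phi.
Proof.
  induction phi; simpl; intro H.
  1,2: destruct H as [H|H]; apply occurs_bound in H; lia.
  1,2: destruct H as [H|H]; [apply IHphi1 in H|apply IHphi2 in H]; lia.
  all: destruct H as [_ H]; apply IHphi in H; lia.
Qed.

Lemma free_for_fresh z y phi : bound phi <= z -> free_for (Var z) y phi.
Proof.
  induction phi; simpl; intro H; auto.
  1,2: split; [apply IHphi1|apply IHphi2]; lia.
  1,2: right; split; [lia|apply IHphi; lia].
Qed.

Lemma sat_fresh M rho phi z d :
  bound phi <= z -> sat M (upd rho z d) phi <-> sat M rho phi.
Proof.
  intro H; apply sat_ext; intros x Hx; apply upd_other.
  apply free_bound in Hx; lia.
Qed.

Lemma subst_term_back y z t :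
  term_bound t <= z -> subst_term z (Var y) (subst_term y (Var z) t) = t.
Proof.
  induction t; simpl; intro H; auto.
  - destruct (Nat.eqb_spec x y); simpl.
    + rewrite Nat.eqb_refl; congruence.
    + destruct (Nat.eqb_spec x z); [lia|easy].
  - now rewrite IHt.
  - rewrite IHt1, IHt2; auto; lia.
  - rewrite IHt1, IHt2; auto; lia.
Qed.

(** Formulas are not identified up to renaming; this is what turns a generalisation over a fresh [z]
    back into one over [y]. *)
Lemma subst_back y z phi :
  bound phi <= z -> subst z (Var y) (subst y (Var z) phi) = phi.
Proof.
  induction phi; simpl; intro H.
  1,2: rewrite !subst_term_back; auto; lia.
  1,2: rewrite IHphi1, IHphi2; auto; lia.
  all: destruct (Nat.eqb_spec y0 z); [lia|]; f_equal.
  all: destruct (Nat.eqb_spec y0 y); [|apply IHphi; lia].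
  all: apply subst_not_free; intro K; apply free_bound in K; lia.
Qed.

Lemma subst_back_free_for y z phi :
  bound phi <= z -> free_for (Var y) z (subst y (Var z) phi).
Proof.
  induction phi; simpl; intro H; auto.
  1,2: split; [apply IHphi1|apply IHphi2]; lia.
  all: destruct (Nat.eqb_spec y0 y).
  1,3: left; intros [_ K]; apply free_bound in K; lia.
  all: right; split; [congruence|apply IHphi; lia].
Qed.

Lemma occurs_subst_gone y t u : ~ occurs y t -> ~ occurs y (subst_term y t u).
Proof.
  intro H; induction u; simpl; auto; try tauto.
  destruct (Nat.eqb_spec x y); simpl; auto; congruence.
Qed.

Lemma free_subst_gone y t phi : ~ occurs y t -> ~ free_in y (subst y t phi).
Proof.
  intro H; induction phi; simpl.
  1,2: pose proof (occurs_subst_gone y t t0 H);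
       pose proof (occurs_subst_gone y t u H); tauto.
  1,2: tauto.
  1,2: destruct (Nat.eqb_spec y0 y); [intuition|tauto].
Qed.

(** * Completeness *)

(** Invariant under substitution and negation, hence a measure for the truth lemma, where instances
    are not subformulas. It later also serves to recognise (case) from its sequents. *)
Fixpoint connectives (phi : formula) : nat :=
  match phi with
  | Eq _ _ | Neq _ _ => 0
  | And a b | Or a b => S (connectives a + connectives b)
  | All _ a | Ex _ a => S (connectives a)
  end.

Lemma connectives_subst y t phi : connectives (subst y t phi) = connectives phi.
Proof.
  induction phi; simpl; auto; now destruct (Nat.eqb y0 y); rewrite ?IHphi.
Qed.

Lemma connectives_neg phi : connectives (neg phi) = connectives phi.
Proof. induction phi; simpl; auto. Qed.

(** * Enumeration of the formulas *)

Fixpoint terms_upto (n : nat) : list term :=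
  match n with
  | 0 => [Zero]
  | S n =>
      let L := terms_upto n in
      L ++ Var n :: map Succ L ++
      map (fun p => Add (fst p) (snd p)) (list_prod L L) ++
      map (fun p => Mul (fst p) (snd p)) (list_prod L L)
  end.

Fixpoint formulas_upto (n : nat) : list formula :=
  match n with
  | 0 => []
  | S n =>
      let L := formulas_upto n in
      let T := terms_upto n in
      L ++
      map (fun p => Eq (fst p) (snd p)) (list_prod T T) ++
      map (fun p => Neq (fst p) (snd p)) (list_prod T T) ++
      map (fun p => And (fst p) (snd p)) (list_prod L L) ++
      map (fun p => Or (fst p) (snd p)) (list_prod L L) ++
      map (fun p => All (fst p) (snd p)) (list_prod (seq 0 n) L) ++
      map (fun p => Ex (fst p) (snd p)) (list_prod (seq 0 n) L)
  end.

Lemma terms_upto_mono n m t : n <= m -> In t (terms_upto n) -> In t (terms_upto m).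
Proof. induction 1; simpl; auto; intro; apply in_or_app; auto. Qed.

Lemma formulas_upto_mono n m t :
  n <= m -> In t (formulas_upto n) -> In t (formulas_upto m).
Proof. induction 1; simpl; auto; intro; apply in_or_app; auto. Qed.

Lemma in_map_pair {A B C} (f : A -> B -> C) a b l l' :
  In a l -> In b l' ->
  In (f a b) (map (fun p => f (fst p) (snd p)) (list_prod l l')).
Proof.
  intros; apply in_map_iff; exists (a, b); split; auto; now apply in_prod.
Qed.

Lemma terms_upto_all t : exists n, In t (terms_upto n).
Proof.
  induction t as [x| |t [n H]|t [n H] u [m K]|t [n H] u [m K]].
  - exists (S x); simpl; apply in_or_app; right; now left.
  - exists 0; now left.
  - exists (S n); simpl; apply in_or_app; right; right.
    apply in_or_app; left; now apply in_map.
  - exists (S (n + m)); simpl; apply in_or_app; right; right.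
    apply in_or_app; right; apply in_or_app; left.
    apply in_map_pair; (eapply terms_upto_mono; [|eassumption]; lia).
  - exists (S (n + m)); simpl; apply in_or_app; right; right.
    apply in_or_app; right; apply in_or_app; right.
    apply in_map_pair; (eapply terms_upto_mono; [|eassumption]; lia).
Qed.

Lemma formulas_upto_all phi : exists n, In phi (formulas_upto n).
Proof.
  induction phi as [t u|t u|a [n H] b [m K]|a [n H] b [m K]|y a [n H]|y a [n H]].
  1,2: destruct (terms_upto_all t) as [n H], (terms_upto_all u) as [m K].
  1-4: exists (S (n + m)).
  5,6: exists (S (n + S y)).
  all: cbn [formulas_upto]; repeat rewrite in_app_iff.
  - right; left; apply in_map_pair; (eapply terms_upto_mono; [|eassumption]; lia).
  - do 2 right; left; apply in_map_pair; (eapply terms_upto_mono; [|eassumption]; lia).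
  - do 3 right; left; apply in_map_pair; (eapply formulas_upto_mono; [|eassumption]; lia).
  - do 4 right; left; apply in_map_pair; (eapply formulas_upto_mono; [|eassumption]; lia).
  - do 5 right; left; apply in_map_pair; [apply in_seq; lia|].
    apply (formulas_upto_mono n (n + S y)); auto; lia.
  - do 6 right; apply in_map_pair; [apply in_seq; lia|].
    apply (formulas_upto_mono n (n + S y)); auto; lia.
Qed.

(** The number [i] codes a stage, a position in the list of that stage, and padding. The padding
    makes every formula recur, which later gives Henkin witnesses beyond any bound. *)
Definition enum (i : nat) : formula :=
  let (n, p) := of_nat i in nth (fst (of_nat p)) (formulas_upto n) Bot.

Lemma enum_infinitely_often phi N : exists i, N <= i /\ enum i = phi.
Proof.
  destruct (formulas_upto_all phi) as [n H].
  apply (In_nth _ _ Bot) in H as [k [_ H]].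
  exists (to_nat (n, to_nat (k, N))); split.
  - pose proof (to_nat_non_decreasing k N).
    pose proof (to_nat_non_decreasing n (to_nat (k, N))). lia.
  - unfold enum; now rewrite cancel_of_to, cancel_of_to.
Qed.

(** Completeness is proved for closed sets rather than for a derivability relation, so that it
    applies to a set closed under further rules such as (IR). *)
Record deductively_closed (Th : formula -> Prop) : Prop := {
  closed_logic : forall phi, logical_axiom phi -> Th phi;
  closed_mp : forall phi psi, Th phi -> Th (Imp phi psi) -> Th psi;
  closed_gen : forall y phi, Th phi -> Th (All y phi)
}.

Definition model_of (Th : formula -> Prop) (M : structure) : Prop :=
  forall phi, Th phi -> forall rho, sat M rho phi.

Lemma valuation_neg v phi :
  boolean_valuation v -> v (neg phi) = true <-> v phi <> true.
Proof.
  intros [H _]; rewrite H; destruct (v phi); simpl; split; congruence.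
Qed.

Lemma valuation_imp v phi psi :
  boolean_valuation v ->
  v (Imp phi psi) = true <-> (v phi = true -> v psi = true).
Proof.
  intros [H [_ K]]; unfold Imp; rewrite K, H.
  destruct (v phi), (v psi); simpl; split; auto; intro A; now discriminate A.
Qed.

(** Assumptions stay inside the formula: a closed set admits generalisation and possibly (IR), so
    enlarging it by an assumption would not amount to an implication. *)
Fixpoint imps (G : list formula) (psi : formula) : formula :=
  match G with
  | [] => psi
  | a :: G => Imp a (imps G psi)
  end.

Lemma valuation_imps v G psi :
  boolean_valuation v ->
  v (imps G psi) = true <->
  ((forall a, In a G -> v a = true) -> v psi = true).
Proof.
  intro bv; induction G as [|a G IH]; simpl.
  - intuition.
  - rewrite (valuation_imp _ _ _ bv), IH; split; intros H K.
    + apply H; intuition.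
    + intro K'; apply H; intros b [<-|Hb]; auto.
Qed.

Ltac valuation :=
  rewrite ?valuation_imp, ?valuation_imps, ?valuation_imp, ?valuation_neg by auto.

Section Completeness.

Context (Th : formula -> Prop) (HTh : deductively_closed Th).

Lemma Th_taut phi : tautology phi -> Th phi.
Proof. intro H; now apply (closed_logic _ HTh), ax_taut. Qed.

Lemma Th_taut1 a c :
  Th a -> (forall v, boolean_valuation v -> v a = true -> v c = true) -> Th c.
Proof.
  intros Ha H; apply (closed_mp _ HTh a); auto; apply Th_taut; intros v bv.
  now apply valuation_imp; auto.
Qed.

Lemma Th_taut2 a b c :
  Th a -> Th b ->
  (forall v, boolean_valuation v -> v a = true -> v b = true -> v c = true) ->
  Th c.
Proof.
  intros Ha Hb H; apply (closed_mp _ HTh b); auto; apply (Th_taut1 a); auto.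
  intros v bv va; apply valuation_imp; auto.
Qed.

Lemma Th_all_imps y G psi :
  (forall a, In a G -> ~ free_in y a) ->
  Th (imps G psi) -> Th (imps G (All y psi)).
Proof.
  intros H K.
  assert (E : Th (Imp (All y (imps G psi)) (imps G (All y psi)))).
  { clear K; induction G as [|a G IH]; simpl.
    - apply Th_taut; intros v bv; now apply valuation_imp.
    - assert (D : Th (Imp (All y (Imp a (imps G psi))) (Imp a (All y (imps G psi))))).
      { apply (closed_logic _ HTh), ax_dist, H; now left. }
      refine (Th_taut2 _ _ _ D (IH _) _).
      + intros; apply H; now right.
      + intros v bv; valuation; tauto. }
  apply (closed_mp _ HTh _ _ (closed_gen _ HTh y _ K) E).
Qed.

Definition inconsistent (G : list formula) : Prop := forall psi, Th (imps G psi).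

Lemma inconsistent_both G a :
  Th (imps G a) -> Th (imps G (neg a)) -> inconsistent G.
Proof.
  intros H K psi; apply (Th_taut2 _ _ _ H K); intros v bv.
  valuation; intros A B C.
  now destruct (B C (A C)).
Qed.

Lemma inconsistent_split G a :
  inconsistent (a :: G) -> inconsistent (neg a :: G) -> inconsistent G.
Proof.
  intros H K psi; apply (Th_taut2 _ _ _ (H psi) (K psi)); intros v bv.
  simpl; valuation.
  destruct (classic (v a = true)); tauto.
Qed.

Definition seq_bound (G : list formula) : nat := list_max (map bound G).

Lemma seq_bound_in G a : In a G -> bound a <= seq_bound G.
Proof.
  intro H; pose proof (proj1 (list_max_le (map bound G) _) (le_n _)) as F.
  rewrite Forall_forall in F; apply F; now apply in_map.
Qed.

(** If the Henkin implication is inconsistent with [G], then [G] yields its premiss and the negation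
    of its conclusion. As [z] is fresh, the premiss generalises over [z] and gives the conclusion
    after renaming. *)
Lemma inconsistent_witness G y chi z :
  seq_bound G <= z -> bound (All y chi) <= z ->
  inconsistent (Imp (subst y (Var z) chi) (All y chi) :: G) -> inconsistent G.
Proof.
  intros HG Hz H.
  simpl in Hz.
  set (c := subst y (Var z) chi) in *.
  assert (D1 : Th (imps G c)).
  { apply (Th_taut1 _ _ (H c)); intros v bv; simpl.
    valuation.
    destruct (classic (v c = true)); tauto. }
  assert (D2 : Th (imps G (neg (All y chi)))).
  { apply (Th_taut1 _ _ (H (neg (All y chi)))); intros v bv.
    cbn [imps]; valuation.
    destruct (classic (v c = true)), (classic (v (All y chi) = true)); tauto. }
  apply inconsistent_both with (All y chi); auto.
  assert (D3 : Th (imps G (All z c))).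
  { apply Th_all_imps; auto; intros a Ha K.
    apply free_bound in K; apply seq_bound_in in Ha; lia. }
  assert (D4 : Th (Imp (All z c) (All y chi))).
  { assert (I : Th (Imp (All z c) chi)).
    { rewrite <- (subst_back y z chi) at 1 by lia.
      apply (closed_logic _ HTh), ax_inst, subst_back_free_for; lia. }
    apply (Th_all_imps y [All z c]) in I; auto.
    intros a [<-|[]] [_ K]; revert K; apply free_subst_gone; simpl; lia. }
  apply (Th_taut2 _ _ _ D3 D4); intros v bv.
  valuation; auto.
Qed.

(** * The Henkin set *)

Context (phi0 : formula) (Hphi0 : ~ Th phi0).

Definition decide (G : list formula) (phi : formula) : list formula :=
  if excluded_middle_informative (inconsistent (phi :: G))
  then neg phi :: G else phi :: G.

(** In the index of the witness, the two bounds ensure freshness, and the summand [i] makes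
    witnesses for the same formula arbitrarily large. *)
Definition extend (i : nat) (G : list formula) : list formula :=
  let G1 := decide G (enum i) in
  match enum i with
  | All y chi =>
      Imp (subst y (Var (i + seq_bound G1 + bound (All y chi))) chi)
          (All y chi) :: G1
  | _ => G1
  end.

Fixpoint stage (i : nat) : list formula :=
  match i with
  | 0 => [neg phi0]
  | S i => extend i (stage i)
  end.

Lemma decide_consistent G phi :
  ~ inconsistent G -> ~ inconsistent (decide G phi).
Proof.
  unfold decide; destruct (excluded_middle_informative _) as [H|H]; auto.
  intros K I; apply K; now apply inconsistent_split with phi.
Qed.

Lemma stage_consistent i : ~ inconsistent (stage i).
Proof.
  induction i as [|i IH].
  - intro H; apply Hphi0; specialize (H phi0).
    apply (Th_taut1 _ _ H); intros v bv; simpl.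
    valuation.
    destruct (classic (v phi0 = true)); tauto.
  - pose proof (decide_consistent _ (enum i) IH) as D.
    simpl; unfold extend; destruct (enum i) as [| | | |y chi|]; auto.
    intro K; apply D; revert K; apply inconsistent_witness; lia.
Qed.

Lemma decide_incl G phi a : In a G -> In a (decide G phi).
Proof. unfold decide; destruct (excluded_middle_informative _); now right. Qed.

Lemma stage_step i a : In a (decide (stage i) (enum i)) -> In a (stage (S i)).
Proof.
  intro H; simpl; unfold extend; destruct (enum i); auto; now right.
Qed.

Lemma stage_mono i j a : i <= j -> In a (stage i) -> In a (stage j).
Proof.
  induction 1; auto; intro; apply stage_step, decide_incl; auto.
Qed.

Definition henkin (phi : formula) : Prop := exists i, In phi (stage i).

Lemma henkin_complete phi : henkin phi \/ henkin (neg phi).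
Proof.
  destruct (enum_infinitely_often phi 0) as [i [_ E]].
  assert (H : In phi (decide (stage i) (enum i)) \/
              In (neg phi) (decide (stage i) (enum i))).
  { rewrite E; unfold decide; destruct (excluded_middle_informative _);
      [right|left]; now left. }
  destruct H as [H|H]; apply stage_step in H; [left|right]; now exists (S i).
Qed.

Lemma henkin_stage D :
  (forall a, In a D -> henkin a) ->
  exists i, forall a, In a D -> In a (stage i).
Proof.
  induction D as [|a D IH]; intro H.
  - now exists 0.
  - destruct IH as [i Hi]; [intros; apply H; now right|].
    destruct (H a (or_introl eq_refl)) as [j Hj].
    exists (i + j); intros b [<-|Hb].
    + apply (stage_mono j); auto; lia.
    + apply (stage_mono i); auto; lia.
Qed.

Lemma henkin_closed D phi :
  (forall a, In a D -> henkin a) -> Th (imps D phi) -> henkin phi.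
Proof.
  intros HD H; destruct (henkin_complete phi) as [K|K]; auto; exfalso.
  destruct (henkin_stage (neg phi :: D)) as [i Hi].
  { intros a [<-|Ha]; auto. }
  apply (stage_consistent i); apply inconsistent_both with phi.
  - apply (Th_taut1 _ _ H); intros v bv; valuation.
    intros A B; apply A; intros; apply B, Hi; now right.
  - apply Th_taut; intros v bv; apply valuation_imps; auto.
    intro B; apply B, Hi; now left.
Qed.

Lemma henkin_theorem phi : Th phi -> henkin phi.
Proof. intro H; apply (henkin_closed []); simpl; tauto. Qed.

Lemma henkin_mp a b : henkin (Imp a b) -> henkin a -> henkin b.
Proof.
  intros H K; apply (henkin_closed [Imp a b; a]).
  - now intros c [<-|[<-|[]]].
  - apply Th_taut; intros v bv; valuation.
    intro C; assert (A := C _ (or_introl eq_refl)).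
    assert (B := C _ (or_intror (or_introl eq_refl))).
    apply (valuation_imp v a b bv) in A; auto.
Qed.

Lemma henkin_neg a : henkin (neg a) <-> ~ henkin a.
Proof.
  split.
  - intros H K; destruct (henkin_stage [neg a; a]) as [i Hi].
    { now intros c [<-|[<-|[]]]. }
    apply (stage_consistent i); apply inconsistent_both with a;
      apply Th_taut; intros v bv; apply (proj2 (valuation_imps v _ _ bv));
      intro B; apply B, Hi; simpl; auto.
  - intro H; destruct (henkin_complete a); tauto.
Qed.

Lemma henkin_and a b : henkin (And a b) <-> henkin a /\ henkin b.
Proof.
  assert (T : forall D c,
    (forall v, boolean_valuation v -> (forall a, In a D -> v a = true) -> v c = true) ->
    (forall a, In a D -> henkin a) -> henkin c).
  { intros D c Hv HD; apply (henkin_closed D); auto; apply Th_taut.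
    intros v bv; apply valuation_imps; auto. }
  split.
  - intro H; split; apply (T [And a b]); try (intros c [<-|[]]; auto);
      intros v bv K; pose proof (K _ (or_introl eq_refl)) as K';
      destruct bv as [_ [E _]]; rewrite E in K';
      now apply andb_prop in K'.
  - intros [H K]; apply (T [a; b]).
    + intros v bv C; destruct bv as [_ [E _]]; rewrite E.
      rewrite (C a), (C b); simpl; auto.
    + now intros c [<-|[<-|[]]].
Qed.

Lemma henkin_or a b : henkin (Or a b) <-> henkin a \/ henkin b.
Proof.
  pose proof (henkin_neg (Or a b)) as H; simpl in H; rewrite henkin_and, !henkin_neg in H.
  tauto.
Qed.

Lemma henkin_inst y t phi :
  free_for t y phi -> henkin (All y phi) -> henkin (subst y t phi).
Proof.
  intros F H; apply (henkin_mp (All y phi)); auto.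
  now apply henkin_theorem, (closed_logic _ HTh), ax_inst.
Qed.

Lemma henkin_witness y chi N :
  exists z, N <= z /\ bound chi <= z /\
    (henkin (subst y (Var z) chi) -> henkin (All y chi)).
Proof.
  destruct (enum_infinitely_often (All y chi) N) as [i [Hi E]].
  set (z := i + seq_bound (decide (stage i) (enum i)) + bound (All y chi)).
  exists z; repeat split.
  - lia.
  - unfold z; simpl; lia.
  - apply henkin_mp; exists (S i); subst z; cbn [stage]; unfold extend.
    rewrite E; now left.
Qed.

Lemma henkin_refl t : henkin (Eq t t).
Proof. apply henkin_theorem, (closed_logic _ HTh), ax_refl. Qed.

Lemma henkin_rewrite y t u a b :
  henkin (Eq t u) ->
  henkin (Eq (subst_term y t a) (subst_term y t b)) ->
  henkin (Eq (subst_term y u a) (subst_term y u b)).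
Proof.
  intro H; apply henkin_mp; revert H; apply henkin_mp.
  apply henkin_theorem, (closed_logic _ HTh).
  now apply (ax_leibniz y t u (Eq a b)).
Qed.

(** Leibniz is applied to the equation between [subst_term y t a] and [a]. Its left side no longer
    contains [y], so only the right side is rewritten. *)
Lemma henkin_congr (f : term -> term) t u :
  (exists y a, f t = subst_term y t a /\ f u = subst_term y u a /\ ~ occurs y t) ->
  henkin (Eq t u) -> henkin (Eq (f t) (f u)).
Proof.
  intros [y [a [-> [-> Hy]]]] H.
  pose proof (henkin_rewrite y t u (subst_term y t a) a H) as K.
  rewrite !(occurs_subst_absent y _ (subst_term y t a)) in K
    by now apply occurs_subst_gone.
  apply K, henkin_refl.
Qed.

Lemma henkin_sym t u : henkin (Eq t u) -> henkin (Eq u t).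
Proof.
  intro H; set (y := term_bound t).
  assert (A : ~ occurs y t) by (intro K; apply occurs_bound in K; lia).
  pose proof (henkin_rewrite y t u (Var y) t H) as K; simpl in K.
  rewrite Nat.eqb_refl, !occurs_subst_absent in K by auto.
  apply K, henkin_refl.
Qed.

Lemma henkin_trans t u w : henkin (Eq t u) -> henkin (Eq u w) -> henkin (Eq t w).
Proof.
  intros H K; set (y := term_bound t).
  assert (A : ~ occurs y t) by (intro C; apply occurs_bound in C; lia).
  pose proof (henkin_rewrite y u w t (Var y) K) as L; simpl in L.
  rewrite Nat.eqb_refl, !occurs_subst_absent in L by auto; auto.
Qed.

Lemma henkin_succ t u : henkin (Eq t u) -> henkin (Eq (Succ t) (Succ u)).
Proof.
  apply (henkin_congr Succ); exists (term_bound t), (Succ (Var (term_bound t))).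
  simpl; rewrite Nat.eqb_refl; repeat split; intro C; apply occurs_bound in C; lia.
Qed.

Lemma henkin_add t u t' u' :
  henkin (Eq t u) -> henkin (Eq t' u') -> henkin (Eq (Add t t') (Add u u')).
Proof.
  intros H K; apply henkin_trans with (Add u t').
  - revert H; apply (henkin_congr (fun x => Add x t')).
    set (y := term_bound (Add t t')); exists y, (Add (Var y) t').
    assert (~ occurs y (Add t t')) by (intro C; apply occurs_bound in C; lia).
    simpl in *; rewrite Nat.eqb_refl, !occurs_subst_absent; tauto.
  - revert K; apply (henkin_congr (fun x => Add u x)).
    set (y := term_bound (Add t' u)); exists y, (Add u (Var y)).
    assert (~ occurs y (Add t' u)) by (intro C; apply occurs_bound in C; lia).
    simpl in *; rewrite Nat.eqb_refl, !occurs_subst_absent; tauto.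
Qed.

Lemma henkin_mul t u t' u' :
  henkin (Eq t u) -> henkin (Eq t' u') -> henkin (Eq (Mul t t') (Mul u u')).
Proof.
  intros H K; apply henkin_trans with (Mul u t').
  - revert H; apply (henkin_congr (fun x => Mul x t')).
    set (y := term_bound (Mul t t')); exists y, (Mul (Var y) t').
    assert (~ occurs y (Mul t t')) by (intro C; apply occurs_bound in C; lia).
    simpl in *; rewrite Nat.eqb_refl, !occurs_subst_absent; tauto.
  - revert K; apply (henkin_congr (fun x => Mul u x)).
    set (y := term_bound (Mul t' u)); exists y, (Mul u (Var y)).
    assert (~ occurs y (Mul t' u)) by (intro C; apply occurs_bound in C; lia).
    simpl in *; rewrite Nat.eqb_refl, !occurs_subst_absent; tauto.
Qed.

Lemma henkin_name t N : exists z, N <= z /\ henkin (Eq (Var z) t).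
Proof.
  set (y := term_bound t).
  assert (A : ~ occurs y t) by (intro C; apply occurs_bound in C; lia).
  destruct (henkin_witness y (Neq (Var y) t) N) as [z [Hz [_ H]]].
  exists z; split; auto.
  simpl in H; rewrite Nat.eqb_refl, occurs_subst_absent in H by auto.
  apply NNPP; intro K; apply henkin_neg, H, (henkin_inst y t) in K; [|exact I].
  simpl in K; rewrite Nat.eqb_refl, occurs_subst_absent in K by auto.
  now apply (henkin_neg (Eq t t)) in K; destruct K; apply henkin_refl.
Qed.

(** Variables serve as Henkin constants: every term is equal to infinitely many
    of them, so the variables modulo provable equality form the model. Taking a
    fresh name of an element avoids capture in the truth lemma. *)
Definition rep (t : term) : var :=
  epsilon (inhabits 0) (fun z => henkin (Eq (Var z) t)).

Lemma rep_spec t : henkin (Eq (Var (rep t)) t).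
Proof.
  unfold rep; apply epsilon_spec.
  destruct (henkin_name t 0) as [z [_ H]]; now exists z.
Qed.

(** Equal terms give extensionally equal predicates to [epsilon], which then makes the same
    choice. *)
Lemma rep_eq t u : rep t = rep u <-> henkin (Eq t u).
Proof.
  split.
  - intro H; apply henkin_trans with (Var (rep u)).
    + rewrite <- H; apply henkin_sym, rep_spec.
    + apply rep_spec.
  - intro H; unfold rep; f_equal; apply functional_extensionality; intro z.
    apply propositional_extensionality; split; intro K.
    + now apply henkin_trans with t.
    + apply henkin_trans with u; auto; now apply henkin_sym.
Qed.

(** Canonical representatives replace a quotient. Each [rep t] is one, since it is equal to [t] in
    the Henkin set. *)
Definition carrier : Set := {x : var | rep (Var x) = x}.

Definition cls (t : term) : carrier :=
  exist _ (rep t) (proj2 (rep_eq (Var (rep t)) t) (rep_spec t)).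

Lemma cls_eq t u : cls t = cls u <-> henkin (Eq t u).
Proof.
  rewrite <- rep_eq; split.
  - intro H; now apply (f_equal (@proj1_sig _ _)) in H.
  - intro H; apply subset_eq_compat; auto.
Qed.

Definition term_model : structure :=
  Structure carrier (cls Zero)
    (fun c => cls (Succ (Var (proj1_sig c))))
    (fun c d => cls (Add (Var (proj1_sig c)) (Var (proj1_sig d))))
    (fun c d => cls (Mul (Var (proj1_sig c)) (Var (proj1_sig d)))).

Definition own : var -> term_model := fun x => cls (Var x).

Lemma eval_own t : eval term_model own t = cls t.
Proof.
  induction t; simpl; auto; rewrite ?IHt, ?IHt1, ?IHt2; apply cls_eq; simpl.
  - apply henkin_succ, rep_spec.
  - apply henkin_add; apply rep_spec.
  - apply henkin_mul; apply rep_spec.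
Qed.

Lemma carrier_name (c : carrier) N : exists z, N <= z /\ c = cls (Var z).
Proof.
  destruct (henkin_name (Var (proj1_sig c)) N) as [z [Hz H]].
  exists z; split; auto.
  apply rep_eq in H; destruct c as [x E]; apply subset_eq_compat; simpl in *.
  congruence.
Qed.

Lemma sat_own_subst y z chi :
  bound chi <= z ->
  sat term_model own (subst y (Var z) chi) <->
  sat term_model (upd own y (cls (Var z))) chi.
Proof. intro H; apply (sat_subst term_model); now apply free_for_fresh. Qed.

Lemma truth n : forall phi, connectives phi <= n ->
  sat term_model own phi <-> henkin phi.
Proof.
  induction n as [n IH] using lt_wf_ind; intros phi Hn.
  assert (Q : forall y chi, connectives chi < n ->
    sat term_model own (All y chi) <-> henkin (All y chi)).
  { intros y chi Hc; split.
    - intro H; destruct (henkin_witness y chi 0) as [z [_ [Hz W]]].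
      apply W, (IH (connectives chi)); auto.
      + now rewrite connectives_subst.
      + apply sat_own_subst; auto; apply H.
    - intros H d; destruct (carrier_name d (bound chi)) as [z [Hz ->]].
      apply sat_own_subst; auto; apply (IH (connectives chi)); auto.
      + now rewrite connectives_subst.
      + apply henkin_inst; auto; now apply free_for_fresh. }
  destruct phi as [t u|t u|a b|a b|y a|y a]; simpl in Hn.
  - simpl; rewrite !eval_own; apply cls_eq.
  - change (Neq t u) with (neg (Eq t u)); rewrite sat_neg, henkin_neg; simpl.
    rewrite !eval_own, cls_eq; tauto.
  - simpl; rewrite henkin_and, (IH (connectives a)), (IH (connectives b)); auto; try lia.
    tauto.
  - simpl; rewrite henkin_or, (IH (connectives a)), (IH (connectives b)); auto; try lia.
    tauto.
  - apply Q; lia.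
  - rewrite <- (neg_involutive (Ex y a)), sat_neg, henkin_neg.
    simpl neg; rewrite Q; [tauto|rewrite connectives_neg; lia].
Qed.

Fixpoint all_below (n : nat) (phi : formula) : formula :=
  match n with
  | 0 => phi
  | S n => All n (all_below n phi)
  end.

Lemma Th_all_below n phi : Th phi -> Th (all_below n phi).
Proof. intro H; induction n; simpl; auto; now apply (closed_gen _ HTh). Qed.

Lemma sat_all_below M n phi : forall rho rho',
  (forall x, n <= x -> rho x = rho' x) ->
  sat M rho (all_below n phi) -> sat M rho' phi.
Proof.
  induction n as [|n IH]; intros rho rho' E H.
  - simpl in H; revert H; apply sat_ext; intros; symmetry; apply E; lia.
  - simpl in H; apply (IH (upd rho n (rho' n))); auto.
    intros x Hx; unfold upd; destruct (Nat.eqb_spec x n); [congruence|].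
    apply E; lia.
Qed.

Lemma term_model_model : model_of Th term_model.
Proof.
  intros phi H rho.
  (* The truth lemma speaks of the assignment [own] only; the universal closure carries the result
     over to [rho]. *)
  assert (K : sat term_model own (all_below (bound phi) phi)).
  { eapply truth; [apply le_n|]; apply henkin_theorem, Th_all_below, H. }
  apply (sat_all_below term_model (bound phi) phi own
    (fun x => if x <? bound phi then rho x else own x)) in K.
  - revert K; apply sat_ext; intros x Hx; apply free_bound in Hx.
    now apply Nat.ltb_lt in Hx as ->.
  - intros x Hx; now apply Nat.ltb_ge in Hx as ->.
Qed.

Lemma term_model_refutes : ~ sat term_model own phi0.
Proof.
  rewrite (truth _ _ (le_n _)); apply henkin_neg; exists 0; now left.
Qed.

End Completeness.

Theorem completeness Th phi :
  deductively_closed Th ->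
  (forall M, model_of Th M -> forall rho, sat M rho phi) -> Th phi.
Proof.
  intros HTh H; apply NNPP; intro K.
  apply (term_model_refutes Th HTh phi K), H, term_model_model.
Qed.

(** * Induction in models *)

Scheme is_sigma_mut := Minimality for is_sigma Sort Prop
  with is_pi_mut := Minimality for is_pi Sort Prop.
Combined Scheme sigma_pi_ind from is_sigma_mut, is_pi_mut.

Lemma sigma_pi_succ :
  (forall k phi, is_sigma k phi -> is_sigma (S k) phi) /\
  (forall k phi, is_pi k phi -> is_pi (S k) phi).
Proof.
  apply sigma_pi_ind; intros.
  - now apply sigma_pi, pi_delta0.
  - now apply sigma_pi.
  - now apply sigma_and.
  - now apply sigma_or.
  - now apply sigma_ex.
  - now apply pi_sigma, sigma_delta0.
  - now apply pi_sigma.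
  - now apply pi_and.
  - now apply pi_or.
  - now apply pi_all.
Qed.

Lemma sigma_mono k m phi : k <= m -> is_sigma k phi -> is_sigma m phi.
Proof. induction 1; auto; intro; apply sigma_pi_succ; auto. Qed.

Lemma delta0_neg phi : delta0 phi -> delta0 (neg phi).
Proof.
  induction 1; simpl; constructor; assumption.
Qed.

Lemma sigma_pi_neg :
  (forall k phi, is_sigma k phi -> is_pi k (neg phi)) /\
  (forall k phi, is_pi k phi -> is_sigma k (neg phi)).
Proof.
  apply sigma_pi_ind; intros; simpl.
  - now apply pi_delta0, delta0_neg.
  - now apply pi_sigma.
  - now apply pi_or.
  - now apply pi_and.
  - now apply pi_all.
  - now apply sigma_delta0, delta0_neg.
  - now apply sigma_pi.
  - now apply sigma_or.
  - now apply sigma_and.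
  - now apply sigma_ex.
Qed.

Lemma upd_comm {A} (rho : var -> A) x y a b :
  x <> y -> upd (upd rho x a) y b = upd (upd rho y b) x a.
Proof.
  intro H; apply functional_extensionality; intro z; unfold upd.
  destruct (Nat.eqb_spec z x), (Nat.eqb_spec z y); congruence.
Qed.

Lemma upd_shadow {A} (rho : var -> A) x a b : upd (upd rho x a) x b = upd rho x b.
Proof.
  apply functional_extensionality; intro z; unfold upd.
  destruct (Nat.eqb_spec z x); congruence.
Qed.

Lemma upd_id {A} (rho : var -> A) x : upd rho x (rho x) = rho.
Proof.
  apply functional_extensionality; intro z; unfold upd.
  destruct (Nat.eqb_spec z x); congruence.
Qed.

(** * The induction rule read in models *)

Section Induction.

Context (U : formula -> Prop) (n : nat) (HQ : forall phi, Q_axiom phi -> U phi).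

Notation model := (model_of (theorem_IR U n)).

Lemma theorem_IR_closed : deductively_closed (theorem_IR U n).
Proof.
  split; [apply th_logic|apply th_mp|apply th_gen].
Qed.

(** Validity of the premisses in every model makes them theorems by completeness, and only then does
    the rule apply. Premisses valid in one given model would not do. *)
Lemma IR_formula x phi :
  is_sigma n phi ->
  (forall M, model M -> forall rho, sat M (upd rho x zero) phi) ->
  (forall M, model M -> forall rho, sat M rho phi ->
     sat M (upd rho x (succ (rho x))) phi) ->
  forall M, model M -> forall rho, sat M rho phi.
Proof.
  intros Hs H0 HS M HM rho.
  assert (T : theorem_IR U n (All x phi)).
  { apply th_IR; auto.
    - apply completeness; [apply theorem_IR_closed|]; intros M' HM' rho'.
      apply sat_subst; [apply free_for_closed; auto|]; now apply H0.
    - apply completeness; [apply theorem_IR_closed|]; intros M' HM' rho'.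
      intro d; apply sat_imp; intro H; apply sat_subst.
      + apply free_for_own; auto.
      + now apply HS in H. }
  rewrite <- (upd_id rho x); apply (HM _ T).
Qed.

Lemma IR_open x phi :
  delta0 phi ->
  (forall M, model M -> forall rho, sat M (upd rho x zero) phi) ->
  (forall M, model M -> forall rho, sat M rho phi ->
     sat M (upd rho x (succ (rho x))) phi) ->
  forall M, model M -> forall rho, sat M rho phi.
Proof.
  intro H; apply IR_formula; apply (sigma_mono 0); [lia|now constructor].
Qed.

Lemma model_Q M phi : model M -> Q_axiom phi -> sat M (fun _ => zero) phi.
Proof. intros HM H; apply HM, th_axiom; auto. Qed.

Definition assign2 {A} (a b : A) : var -> A :=
  fun x => match x with 0 => a | _ => b end.

Definition assign3 {A} (a b c : A) : var -> A :=
  fun x => match x with 0 => a | 1 => b | _ => c end.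

Declare Scope model_scope.
Delimit Scope model_scope with model.
Local Open Scope model_scope.
Local Notation "x + y" := (add x y) : model_scope.
Local Notation "x * y" := (mul x y) : model_scope.

(** * Arithmetic of the models *)

Section Arithmetic.

Context (M : structure) (HM : model M).
Implicit Types a b c d : M.

Lemma succ_nonzero a : succ a <> zero.
Proof. exact (model_Q M _ HM Q_succ_nonzero a). Qed.

Lemma succ_inj a b : succ a = succ b -> a = b.
Proof.
  destruct (model_Q M _ HM Q_succ_inj a b) as [H|H]; cbn in H; tauto.
Qed.

Lemma zero_or_succ a : a = zero \/ exists b, a = succ b.
Proof. exact (model_Q M _ HM Q_pred a). Qed.

Lemma add_zero_r a : a + zero = a.
Proof. exact (model_Q M _ HM Q_add_zero a). Qed.

Lemma add_succ_r a b : a + succ b = succ (a + b).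
Proof. exact (model_Q M _ HM Q_add_succ a b). Qed.

Lemma mul_zero_r a : a * zero = zero.
Proof. exact (model_Q M _ HM Q_mul_zero a). Qed.

Lemma mul_succ_r a b : a * succ b = a * b + a.
Proof. exact (model_Q M _ HM Q_mul_succ a b). Qed.

End Arithmetic.

(** The current model is cleared because the premisses concern an arbitrary one; the elements at
    hand enter only through [assignment]. *)
Ltac induct x phi assignment :=
  refine (IR_open x phi _ _ _ _ _ assignment);
  [ repeat constructor
  | cbn; clear - HQ; intros M HM rho
  | cbn; clear - HQ; intros M HM rho IH
  | assumption ].

Lemma add_zero_l M (HM : model M) (a : M) : zero + a = a.
Proof.
  induct 0 (Eq (Add Zero (Var 0)) (Var 0)) (assign2 a a).
  - now apply add_zero_r.
  - rewrite add_succ_r by auto; congruence.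
Qed.

Lemma add_succ_l M (HM : model M) (a b : M) : succ a + b = succ (a + b).
Proof.
  induct 1 (Eq (Add (Succ (Var 0)) (Var 1)) (Succ (Add (Var 0) (Var 1)))) (assign2 a b).
  - now rewrite !add_zero_r.
  - rewrite !add_succ_r by auto; congruence.
Qed.

Lemma add_comm M (HM : model M) (a b : M) : a + b = b + a.
Proof.
  induct 1 (Eq (Add (Var 0) (Var 1)) (Add (Var 1) (Var 0))) (assign2 a b).
  - now rewrite add_zero_r, add_zero_l.
  - rewrite add_succ_r, add_succ_l by auto; congruence.
Qed.

Lemma add_assoc M (HM : model M) (a b c : M) : a + (b + c) = a + b + c.
Proof.
  induct 2 (Eq (Add (Var 0) (Add (Var 1) (Var 2))) (Add (Add (Var 0) (Var 1)) (Var 2)))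
    (assign3 a b c).
  - now rewrite !add_zero_r.
  - rewrite !add_succ_r by auto; congruence.
Qed.

Lemma mul_zero_l M (HM : model M) (a : M) : zero * a = zero.
Proof.
  induct 0 (Eq (Mul Zero (Var 0)) Zero) (assign2 a a).
  - now apply mul_zero_r.
  - now rewrite mul_succ_r, add_zero_r.
Qed.

Lemma mul_succ_l M (HM : model M) (a b : M) : succ a * b = a * b + b.
Proof.
  induct 1 (Eq (Mul (Succ (Var 0)) (Var 1)) (Add (Mul (Var 0) (Var 1)) (Var 1)))
    (assign2 a b).
  - now rewrite !mul_zero_r, add_zero_r.
  - rewrite !mul_succ_r, !add_succ_r, IH by auto.
    rewrite <- !add_assoc by auto; f_equal; f_equal; now apply add_comm.
Qed.

Lemma mul_comm M (HM : model M) (a b : M) : a * b = b * a.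
Proof.
  induct 1 (Eq (Mul (Var 0) (Var 1)) (Mul (Var 1) (Var 0))) (assign2 a b).
  - now rewrite mul_zero_r, mul_zero_l.
  - rewrite mul_succ_r, mul_succ_l by auto; congruence.
Qed.

Lemma mul_add_distr_r M (HM : model M) (a b c : M) : (a + b) * c = a * c + b * c.
Proof.
  induct 2 (Eq (Mul (Add (Var 0) (Var 1)) (Var 2))
               (Add (Mul (Var 0) (Var 2)) (Mul (Var 1) (Var 2)))) (assign3 a b c).
  - now rewrite !mul_zero_r, add_zero_r.
  - rewrite !mul_succ_r, IH, !add_assoc by auto; f_equal.
    rewrite <- !add_assoc by auto; f_equal; now apply add_comm.
Qed.

Lemma mul_assoc M (HM : model M) (a b c : M) : a * (b * c) = a * b * c.
Proof.
  induct 2 (Eq (Mul (Var 0) (Mul (Var 1) (Var 2))) (Mul (Mul (Var 0) (Var 1)) (Var 2)))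
    (assign3 a b c).
  - now rewrite !mul_zero_r.
  - rewrite !mul_succ_r by auto.
    now rewrite (mul_comm _ HM (rho 0) (_ + _)), mul_add_distr_r,
      (mul_comm _ HM (rho 1 * rho 2)), IH, (mul_comm _ HM (rho 1) (rho 0)) by auto.
Qed.

Lemma add_cancel_r M (HM : model M) (a b c : M) : a + c = b + c -> a = b.
Proof.
  enough (H : a + c <> b + c \/ a = b) by tauto.
  induct 2 (Or (Neq (Add (Var 0) (Var 2)) (Add (Var 1) (Var 2))) (Eq (Var 0) (Var 1)))
    (assign3 a b c).
  - rewrite !add_zero_r by auto; apply or_comm, classic.
  - rewrite !add_succ_r by auto; destruct IH as [IH|IH]; auto.
    left; intro H; apply IH; revert H; now apply succ_inj.
Qed.

Lemma model_semiring M (HM : model M) :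
  semi_ring_theory (@zero M) (succ zero) add mul eq.
Proof.
  split; intros.
  - now apply add_zero_l.
  - now apply add_comm.
  - now apply add_assoc.
  - now rewrite mul_succ_l, mul_zero_l, add_zero_l.
  - now apply mul_zero_l.
  - now apply mul_comm.
  - now apply mul_assoc.
  - now apply mul_add_distr_r.
Qed.

(** * Order and pairing *)

Definition le {M : structure} (a b : M) : Prop := exists c, a + c = b.
Definition lt {M : structure} (a b : M) : Prop := exists c, a + succ c = b.

(** [Le] itself is not built from bounded quantifiers, hence the bound on the witness. *)
Definition leF (x y : var) : formula :=
  let z := S (x + y) in
  Ex z (And (Le (S z) (Var z) (Var y)) (Eq (Add (Var x) (Var z)) (Var y))).

Lemma leF_delta0 x y : delta0 (leF x y).
Proof. apply delta0_ex; simpl; try lia; constructor. Qed.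

Lemma sat_leF M (HM : model M) rho x y : sat M rho (leF x y) <-> le (rho x) (rho y).
Proof.
  unfold leF; cbn -[upd Nat.add].
  split.
  - intros [d [_ H]]; exists d.
    rewrite upd_same, !upd_other in H by lia; auto.
  - intros [d H]; exists d; rewrite upd_same, !upd_other by lia; split; auto.
    exists (rho x).
    rewrite upd_same, !(upd_other _ _ (S (S (x + y)))), upd_same, upd_other by lia.
    exact H.
Qed.

Lemma le_total M (HM : model M) (a b : M) : le a b \/ le b a.
Proof.
  cut (sat M (assign2 a b) (Or (leF 0 1) (leF 1 0))).
  { intros [H|H]; apply sat_leF in H; auto. }
  refine (IR_open 0 (Or (leF 0 1) (leF 1 0)) _ _ _ _ HM _); clear - HQ.
  - constructor; apply leF_delta0.
  - intros M HM rho; left; apply sat_leF; auto; exists (rho 1); now apply add_zero_l.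
  - intros M HM rho [H|H]; apply sat_leF in H; auto; destruct H as [c H].
    + destruct (zero_or_succ M HM c) as [->|[d ->]].
      * right; apply sat_leF; auto; exists (succ zero); cbn.
        rewrite <- H, !add_succ_r, !add_zero_r; auto.
      * left; apply sat_leF; auto; exists d; cbn.
        rewrite <- H, add_succ_r, add_succ_l; auto.
    + right; apply sat_leF; auto; exists (succ c); cbn.
      rewrite <- H, add_succ_r; auto.
Qed.

Section Order.

Context (M : structure) (HM : model M).
Implicit Types a b c d : M.

Let SR := model_semiring M HM.
Add Ring model_ring : SR.

Lemma succ_add_one a : succ a = a + succ zero.
Proof. now rewrite add_succ_r, add_zero_r. Qed.

Lemma le_refl a : le a a.
Proof. exists zero; ring. Qed.

Lemma le_trans a b c : le a b -> le b c -> le a c.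
Proof. intros [d <-] [e <-]; exists (d + e); ring. Qed.

Lemma le_add_l a b : le a (b + a).
Proof. exists b; ring. Qed.

Lemma le_add_r a b : le a (a + b).
Proof. exists b; ring. Qed.

Lemma le_zero a : le a zero -> a = zero.
Proof.
  intros [c H]; destruct (zero_or_succ M HM c) as [->|[d ->]].
  - now rewrite add_zero_r in H.
  - rewrite add_succ_r in H by auto; now apply succ_nonzero in H.
Qed.

Lemma lt_succ a b : lt a (succ b) <-> le a b.
Proof.
  split; intros [c H]; exists c.
  - rewrite add_succ_r in H by auto; revert H; now apply succ_inj.
  - rewrite add_succ_r by auto; congruence.
Qed.

Lemma le_lt_eq a b : le a b <-> lt a b \/ a = b.
Proof.
  split.
  - intros [c H]; destruct (zero_or_succ M HM c) as [->|[d ->]].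
    + right; now rewrite add_zero_r in H.
    + left; now exists d.
  - intros [[c H]| ->]; [now exists (succ c)|apply le_refl].
Qed.

Lemma not_lt_zero a : ~ lt a zero.
Proof. intros [c H]; rewrite add_succ_r in H by auto; now apply succ_nonzero in H. Qed.

(** Needs no halving, unlike the Cantor pairing. It is not onto, but it is injective, because the
    last summand is too small to reach the next square, and strictly increasing in each argument. *)
Definition pair a b : M := (a + b) * (a + b) + a.

Lemma pair_sum_not_lt a b a' b' : pair a b = pair a' b' -> ~ lt (a + b) (a' + b').
Proof.
  unfold pair; intros H [d E]; rewrite <- E, succ_add_one in H.
  (* Cancelling the square of [a + b] leaves [a] equal to the sum of a successor and [a]. *)
  assert (K : zero + a = succ ((a + b) * d + b + (a + b) * d
     + b + a + d * d + d + d + a') + a).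
  { apply (add_cancel_r M HM) with ((a + b) * (a + b)).
    transitivity ((a + b) * (a + b) + a); [ring|].
    rewrite H, (succ_add_one (_ + _)); ring. }
  apply (add_cancel_r M HM) in K; symmetry in K; now apply succ_nonzero in K.
Qed.

Lemma pair_inj a b a' b' : pair a b = pair a' b' -> a = a' /\ b = b'.
Proof.
  intro H.
  assert (E : a + b = a' + b').
  { destruct (le_total M HM (a + b) (a' + b')) as [L|L];
      apply le_lt_eq in L as [L|L]; auto; exfalso; revert L;
      apply pair_sum_not_lt; congruence. }
  unfold pair in H; rewrite E, !(add_comm M HM (_ * _)) in H.
  apply (add_cancel_r M HM) in H; subst a'; split; auto.
  rewrite !(add_comm M HM a) in E; now apply (add_cancel_r M HM) in E.
Qed.

Lemma pair_lt_l a b d : lt d a -> lt (pair d b) (pair a b).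
Proof.
  intros [c <-]; unfold pair; rewrite succ_add_one.
  (* With s = d + b, the squares differ by (c + 1)(2s + c + 1) and the last summands by c + 1; one
     is taken off because of the [succ] in [lt]. *)
  exists (c + (c + succ zero) * (d + b + d + b + c + succ zero)).
  rewrite (succ_add_one (_ + _)); ring.
Qed.

Lemma pair_lt_r a b d : lt d b -> lt (pair a d) (pair a b).
Proof.
  intros [c <-]; unfold pair; rewrite succ_add_one.
  exists (c * (a + d + a + d + c + succ zero) + (a + d + a + d + c)).
  rewrite (succ_add_one (_ + _)); ring.
Qed.

Lemma le_pair_l a b : le a (pair a b).
Proof. apply le_add_l. Qed.

Lemma le_pair_r a b : le b (pair a b).
Proof.
  destruct (zero_or_succ M HM b) as [->|[c ->]].
  - exists (pair a zero); ring.
  - unfold pair; rewrite succ_add_one.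
    exists ((a + c) * (a + c) + a + a + c + a); ring.
Qed.

End Order.

Local Close Scope model_scope.

(** * Predicates definable uniformly in all models *)

Definition pred := forall M : structure, (var -> M) -> Prop.

Definition defines (phi : formula) (R : pred) : Prop :=
  forall M, model M -> forall rho, R M rho <-> sat M rho phi.

(** Unlike [is_sigma], this is invariant under equivalence in the models, so complexity can be
    computed from the meaning of a formula. *)
Definition Sigma (k : nat) (R : pred) : Prop :=
  exists phi, is_sigma k phi /\ defines phi R.

Definition Pi (k : nat) (R : pred) : Prop :=
  exists phi, is_pi k phi /\ defines phi R.

Definition pnot (R : pred) : pred := fun M rho => ~ R M rho.
Definition pand (R R' : pred) : pred := fun M rho => R M rho /\ R' M rho.
Definition por (R R' : pred) : pred := fun M rho => R M rho \/ R' M rho.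
Definition pex (y : var) (R : pred) : pred :=
  fun M rho => exists d, R M (upd rho y d).
Definition ball (y x : var) (R : pred) : pred :=
  fun M rho => forall d, le d (rho x) -> R M (upd rho y d).
Definition bex (y x : var) (R : pred) : pred :=
  fun M rho => exists d, le d (rho x) /\ R M (upd rho y d).

Lemma Sigma_equiv k R R' :
  (forall M, model M -> forall rho, R M rho <-> R' M rho) -> Sigma k R -> Sigma k R'.
Proof.
  intros E [phi [H D]]; exists phi; split; auto; intros M HM rho.
  rewrite <- E by auto; now apply D.
Qed.

Lemma Pi_equiv k R R' :
  (forall M, model M -> forall rho, R M rho <-> R' M rho) -> Pi k R -> Pi k R'.
Proof.
  intros E [phi [H D]]; exists phi; split; auto; intros M HM rho.
  rewrite <- E by auto; now apply D.
Qed.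

Lemma Sigma_not k R : Pi k R -> Sigma k (pnot R).
Proof.
  intros [phi [H D]]; exists (neg phi); split; [now apply sigma_pi_neg|].
  intros M HM rho; rewrite sat_neg; unfold pnot; now rewrite (D M HM rho).
Qed.

Lemma Pi_not k R : Sigma k R -> Pi k (pnot R).
Proof.
  intros [phi [H D]]; exists (neg phi); split; [now apply sigma_pi_neg|].
  intros M HM rho; rewrite sat_neg; unfold pnot; now rewrite (D M HM rho).
Qed.

Lemma Pi_of_not k R : Sigma k (pnot R) -> Pi k R.
Proof.
  intro H; apply Pi_not in H; revert H; apply Pi_equiv; intros M HM rho.
  unfold pnot; tauto.
Qed.

Lemma Sigma_mono k m R : k <= m -> Sigma k R -> Sigma m R.
Proof.
  intros L [phi [H D]]; exists phi; split; auto; now apply (sigma_mono k).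
Qed.

Lemma Sigma_of_Pi k R : Pi k R -> Sigma (S k) R.
Proof. intros [phi [H D]]; exists phi; split; auto; now apply sigma_pi. Qed.

Lemma Sigma_and k R R' : Sigma k R -> Sigma k R' -> Sigma k (pand R R').
Proof.
  intros [phi [H D]] [psi [K E]]; exists (And phi psi); split.
  - destruct k; [|now apply sigma_and].
    inversion H; inversion K; subst; now apply sigma_delta0, delta0_and.
  - intros M HM rho; simpl; unfold pand; now rewrite (D M HM rho), (E M HM rho).
Qed.

Lemma Sigma_or k R R' : Sigma k R -> Sigma k R' -> Sigma k (por R R').
Proof.
  intros [phi [H D]] [psi [K E]]; exists (Or phi psi); split.
  - destruct k; [|now apply sigma_or].
    inversion H; inversion K; subst; now apply sigma_delta0, delta0_or.
  - intros M HM rho; simpl; unfold por; now rewrite (D M HM rho), (E M HM rho).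
Qed.

Lemma Pi_and k R R' : Pi k R -> Pi k R' -> Pi k (pand R R').
Proof.
  intros H K; apply Pi_of_not.
  apply Sigma_equiv with (por (pnot R) (pnot R')).
  - intros M HM rho; unfold por, pnot, pand; tauto.
  - apply Sigma_or; now apply Sigma_not.
Qed.

Lemma Pi_or k R R' : Pi k R -> Pi k R' -> Pi k (por R R').
Proof.
  intros H K; apply Pi_of_not.
  apply Sigma_equiv with (pand (pnot R) (pnot R')).
  - intros M HM rho; unfold por, pnot, pand; tauto.
  - apply Sigma_and; now apply Sigma_not.
Qed.

Lemma Sigma_ex k y R : Sigma (S k) R -> Sigma (S k) (pex y R).
Proof.
  intros [phi [H D]]; exists (Ex y phi); split; [now apply sigma_ex|].
  intros M HM rho; simpl; unfold pex; split; intros [d K]; exists d; now apply D.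
Qed.

Lemma Sigma_le x y : Sigma 0 (fun M rho => le (rho x) (rho y)).
Proof.
  exists (leF x y); split; [apply sigma_delta0, leF_delta0|].
  intros M HM rho; symmetry; now apply sat_leF.
Qed.

Lemma Sigma0_Pi0 R : Sigma 0 R <-> Pi 0 R.
Proof.
  split; intros [phi [H D]]; exists phi; split; auto; inversion H; subst;
    now constructor.
Qed.

Lemma ball_not y x R M rho : pnot (bex y x (pnot R)) M rho <-> ball y x R M rho.
Proof.
  unfold pnot, bex, ball; split.
  - intros H d Hd; apply NNPP; intro K; apply H; eauto.
  - intros H [d [Hd K]]; auto.
Qed.

Lemma bex_not y x R M rho : pnot (ball y x (pnot R)) M rho <-> bex y x R M rho.
Proof.
  unfold pnot, bex, ball; split.
  - intro H; apply not_all_ex_not in H as [d H]; exists d; tauto.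
  - intros [d [Hd K]] H; eapply H; eauto.
Qed.

Lemma sat_Le M (HM : model M) rho x y z :
  z <> x -> z <> y -> sat M rho (Le z (Var y) (Var x)) <-> le (rho y) (rho x).
Proof.
  intros Nx Ny; simpl; split; intros [c H]; exists c.
  - rewrite upd_same, !upd_other in H by auto; rewrite <- H.
    now apply add_comm.
  - rewrite upd_same, !upd_other by auto; rewrite <- H.
    now apply add_comm.
Qed.

Lemma Sigma_bex k y x R : y <> x -> Sigma k R -> Sigma k (bex y x R).
Proof.
  intros N H; destruct k as [|k].
  - destruct H as [phi [H D]]; inversion H; subst.
    exists (Ex y (And (Le (S (x + y)) (Var y) (Var x)) phi)); split.
    + constructor; apply delta0_ex; simpl; auto; lia.
    + intros M HM rho; cbn [sat]; unfold bex.
      split; intros [d K]; exists d; revert K;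
        rewrite (D M HM (upd rho y d)), sat_Le, upd_same, upd_other by (auto; lia); auto.
  - apply Sigma_equiv with (pex y (pand (fun M rho => le (rho y) (rho x)) R)).
    + intros M HM rho; unfold pex, pand, bex.
      split; intros [d K]; exists d; revert K; rewrite upd_same, upd_other; auto.
    + apply Sigma_ex, Sigma_and; auto; apply (Sigma_mono 0); [lia|apply Sigma_le].
Qed.

Lemma Pi_ball k y x R : y <> x -> Pi k R -> Pi k (ball y x R).
Proof.
  intros N H; apply Sigma_not, (Sigma_bex k y x) in H; auto.
  apply Pi_not in H; revert H; apply Pi_equiv; intros; apply ball_not.
Qed.

(** The form in which collection is used: a bounded universal quantifier is absorbed although the
    formula may begin with unbounded existential ones. *)
Definition bounded_closed (k : nat) : Prop :=
  forall y x R, y <> x -> Sigma k R -> Sigma k (ball y x R).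

Lemma Pi_bex k y x R :
  bounded_closed k -> y <> x -> Pi k R -> Pi k (bex y x R).
Proof.
  intros B N H; apply Sigma_not, (B y x) in H; auto.
  apply Pi_not in H; revert H; apply Pi_equiv; intros; apply bex_not.
Qed.

Lemma bounded_closed_zero : bounded_closed 0.
Proof.
  intros y x R N H; now apply Sigma0_Pi0, Pi_ball, Sigma0_Pi0.
Qed.

(** Lets two bounds on witnesses be replaced by their sum. *)
Definition monotone (u : var) (R : pred) : Prop :=
  forall M, model M -> forall rho c d,
    le c d -> R M (upd rho u c) -> R M (upd rho u d).

(** Under [bounded_closed k] a block of existential quantifiers can be merged
    into one: a bound [u] on all witnesses. *)
Lemma sigma_normal_form k phi :
  bounded_closed k -> is_sigma (S k) phi ->
  forall u, bound phi <= u -> exists R,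
    Pi k R /\ monotone u R /\ defines phi (pex u R) /\
    (forall M rho z d, model M -> bound phi <= z -> z <> u ->
       R M (upd rho z d) <-> R M rho).
Proof.
  intros B H; remember (S k) as m eqn:E.
  induction H as [phi H|m phi H|m phi psi H1 IH1 H2 IH2|m phi psi H1 IH1 H2 IH2|m y phi H IH];
    try discriminate; injection E as ->; intros u Hu; simpl in Hu.
  - exists (fun M rho => sat M rho phi).
    split; [|split; [|split]].
    + now exists phi.
    + intros M HM rho c d _; now rewrite !sat_fresh.
    + intros M HM rho; symmetry; split; [intro K; exists zero|intros [d K]; revert K];
        now apply sat_fresh.
    + intros M rho z d HM Hz N; now apply sat_fresh.
  - destruct (IH1 eq_refl u) as [R1 [P1 [M1 [D1 I1]]]]; [lia|].
    destruct (IH2 eq_refl u) as [R2 [P2 [M2 [D2 I2]]]]; [lia|].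
    exists (pand R1 R2); split; [|split; [|split]].
    + now apply Pi_and.
    + intros M HM rho c d L [K1 K2]; split;
        [apply (M1 M HM rho c)|apply (M2 M HM rho c)]; auto.
    + intros M HM rho; symmetry; simpl; rewrite <- (D1 M HM rho), <- (D2 M HM rho).
      split; [|intros [d [K1 K2]]; split; now exists d].
      intros [[c K1] [d K2]]; exists (add c d); split.
      * revert K1; apply M1; auto; now apply le_add_r.
      * revert K2; apply M2; auto; now apply le_add_l.
    + intros M rho z d HM Hz N; simpl in Hz; unfold pand.
      rewrite I1, I2; auto; try lia; tauto.
  - destruct (IH1 eq_refl u) as [R1 [P1 [M1 [D1 I1]]]]; [lia|].
    destruct (IH2 eq_refl u) as [R2 [P2 [M2 [D2 I2]]]]; [lia|].
    exists (por R1 R2); split; [|split; [|split]].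
    + now apply Pi_or.
    + intros M HM rho c d L [K|K]; [left; apply (M1 M HM rho c)|right; apply (M2 M HM rho c)];
        auto.
    + intros M HM rho; symmetry; simpl; rewrite <- (D1 M HM rho), <- (D2 M HM rho).
      unfold pex, por; firstorder.
    + intros M rho z d HM Hz N; simpl in Hz; unfold por.
      rewrite I1, I2; auto; try lia; tauto.
  - destruct (IH eq_refl u) as [R [P [Mo [D I]]]]; [lia|].
    assert (Nyu : y <> u) by lia.
    (* The same [u] bounds the quantified variable and the inner witnesses; [bounded_closed k] keeps
       the matrix in [Pi k]. *)
    exists (bex y u R); split; [|split; [|split]].
    + now apply Pi_bex.
    + intros M HM rho c d L [e [Le1 K]]; rewrite upd_same in Le1.
      exists e; rewrite upd_same; split; [now apply le_trans with c|].
      rewrite upd_comm in * by auto; revert K; now apply Mo.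
    + intros M HM rho; simpl; unfold pex, bex; split.
      * intros [c [d [_ K]]]; exists d; apply (D M HM); exists c.
        now rewrite upd_comm by auto.
      * intros [d K]; apply (D M HM) in K as [c K].
        exists (add d c), d; rewrite upd_same; split; [now apply le_add_r|].
        rewrite upd_comm by auto; revert K; apply Mo; auto; now apply le_add_l.
    + intros M rho z d HM Hz N; simpl in Hz; unfold bex.
      split; intros [e [L K]]; exists e; rewrite upd_other in * by auto; (split; [auto|]).
      * rewrite upd_comm in K by lia; revert K; apply I; auto; lia.
      * rewrite upd_comm by lia; apply I; auto; lia.
Qed.

Lemma IR_pred x R :
  Sigma n R ->
  (forall M, model M -> forall rho, R M (upd rho x zero)) ->
  (forall M, model M -> forall rho, R M rho -> R M (upd rho x (succ (rho x)))) ->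
  forall M, model M -> forall rho, R M rho.
Proof.
  intros [phi [H D]] H0 HS M HM rho; apply (D M HM).
  revert M HM rho; apply (IR_formula x); auto.
  - intros M HM rho; now apply (D M HM), H0.
  - intros M HM rho K; now apply (D M HM), HS, (D M HM).
Qed.

Lemma le_succ M (HM : model M) (a b : M) : le a (succ b) -> le a b \/ a = succ b.
Proof.
  intro H; apply le_lt_eq in H as [H|H]; auto; left; now apply lt_succ.
Qed.

(** [E] says that [phi] holds for all values of [y] up to [j], with a common
    bound for the witnesses. This is stronger than the bounded universal
    quantification of [phi], which need not be in [Sigma m] without collection. *)
Lemma bounded_witness m phi y j :
  match m with 0 => True | S k => bounded_closed k end ->
  is_sigma m phi -> bound phi + y + 2 <= j ->
  exists E, Sigma m E /\
    forall M, model M -> forall rho,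
      (E M rho -> forall d, le d (rho j) -> sat M (upd rho y d) phi) /\
      (sat M (upd rho y zero) phi -> E M (upd rho j zero)) /\
      (E M rho -> sat M (upd rho y (succ (rho j))) phi ->
         E M (upd rho j (succ (rho j)))).
Proof.
  intros B H Hj; destruct m as [|k].
  - exists (ball y j (fun M rho => sat M rho phi)); split.
    { apply bounded_closed_zero; [lia|now exists phi]. }
    intros M HM rho; unfold ball; rewrite !upd_same; split; [|split].
    + auto.
    + intros K d Hd; apply le_zero in Hd as ->; auto.
      rewrite upd_comm by lia; apply sat_fresh; auto; lia.
    + intros K L d Hd; rewrite upd_comm by lia; apply sat_fresh; [lia|].
      apply le_succ in Hd as [Hd| ->]; auto.
  - set (u := bound phi + y + 1).
    destruct (sigma_normal_form k phi B H u) as [R [P [Mo [D I]]]]; [lia|].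
    exists (pex u (ball y j R)); split.
    { apply Sigma_ex, Sigma_of_Pi, Pi_ball; auto; lia. }
    intros M HM rho; unfold pex, ball; split; [|split].
    + intros [v K] d Hd; apply (D M HM); exists v; rewrite upd_comm by lia.
      apply K; rewrite upd_other by lia; auto.
    + intro K; apply (D M HM) in K as [v K]; exists v; intros d Hd.
      rewrite upd_other, upd_same in Hd by lia; apply le_zero in Hd as ->; auto.
      rewrite upd_comm, (upd_comm rho), (upd_comm _ j) by lia.
      apply I; auto; lia.
    (* The sum of the old common bound and the bound for the new value serves both, by
       monotonicity. *)
    + intros [v K] L; apply (D M HM) in L as [w L]; exists (add v w); intros d Hd.
      rewrite upd_other, upd_same in Hd by lia.
      rewrite upd_comm, (upd_comm rho), (upd_comm _ j) by lia.
      apply I; [auto|lia|lia|]; apply le_succ in Hd as [Hd| ->]; auto.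
      * apply Mo with v; auto; [now apply le_add_r|].
        rewrite upd_comm by lia; apply K; rewrite upd_other by lia; auto.
      * apply Mo with w; auto; now apply le_add_l.
Qed.

(** Collection by induction on [j]. The assumption [ball y x R] cannot be put beside the rule, so
    its negation becomes a disjunct of the induction formula. That negation is [Sigma (S (S k))],
    whence the bound on the level. *)
Lemma bounded_closed_succ k : S (S k) <= n -> bounded_closed k -> bounded_closed (S k).
Proof.
  intros Hn B y x R N [phi [H D]].
  set (j := bound phi + y + x + 2).
  destruct (bounded_witness (S k) phi y j B H) as [E [SE HE]]; [lia|].
  assert (W : forall M, model M -> forall rho,
    por (pnot (ball y x R))
      (por (pnot (fun M rho => le (rho j) (rho x))) E) M rho).
  { assert (J : forall M, model M -> forall rho a,
      ball y x R M (upd rho j a) -> ball y x R M rho).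
    { intros M HM rho a K d Hd; apply (D M HM).
      apply (sat_fresh M _ phi j a); [lia|]; rewrite upd_comm by lia.
      apply (D M HM), K; rewrite upd_other by lia; auto. }
    apply (IR_pred j).
    - apply (Sigma_mono (S (S k))); auto.
      apply Sigma_or; [|apply Sigma_or].
      + apply Sigma_equiv with (bex y x (pnot R)).
        { intros M HM rho; pose proof (ball_not y x R M rho); unfold pnot in *; tauto. }
        apply Sigma_bex; auto; apply Sigma_of_Pi, Pi_not; now exists phi.
      + apply (Sigma_mono 0), Sigma_not, Sigma0_Pi0, Sigma_le; lia.
      + apply (Sigma_mono (S k)); auto.
    - intros M HM rho.
      destruct (classic (ball y x R M (upd rho j zero))) as [K|K]; [|now left].
      right; right; apply HE; auto; apply (D M HM), (J M HM _ _ K).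
      exists (rho x); now apply add_zero_l.
    - intros M HM rho IH.
      destruct (classic (ball y x R M (upd rho j (succ (rho j))))) as [K|K]; [|now left].
      apply J in K; auto; right; unfold por, pnot; rewrite upd_same, upd_other by lia.
      destruct (classic (le (succ (rho j)) (rho x))) as [L|L]; [right|now left].
      destruct IH as [IH|[IH|IH]]; [now destruct IH| |].
      + destruct IH; apply le_trans with (succ (rho j)); auto.
        exists (succ zero); now rewrite add_succ_r, add_zero_r.
      + apply HE; auto; apply (D M HM), K, L. }
  (* The two inequalities give [j] the value of [x], which avoids a substitution in [E]. *)
  apply Sigma_equiv with (bex j x (pand (fun M rho => le (rho x) (rho j)) E)).
  - intros M HM rho; split.
    + intros [a [_ [L K]]] d Hd; rewrite upd_same, upd_other in L by lia.
      apply (D M HM), (sat_fresh M _ phi j a); [lia|]; rewrite upd_comm by lia.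
      apply (HE M HM); auto; rewrite upd_same; now apply le_trans with (rho x).
    + intro K; exists (rho x); split; [now apply le_refl|].
      split; [rewrite upd_same, upd_other by lia; now apply le_refl|].
      destruct (W M HM (upd rho j (rho x))) as [L|[L|L]]; auto; exfalso; apply L.
      * intros d Hd; rewrite upd_other in Hd by lia.
        apply (D M HM); rewrite upd_comm by lia; apply sat_fresh; [lia|].
        apply (D M HM); auto.
      * rewrite upd_same, upd_other by lia; now apply le_refl.
  - apply Sigma_bex; [lia|]; apply Sigma_and; auto.
    apply (Sigma_mono 0); [lia|apply Sigma_le].
Qed.

Lemma bounded_closed_below k : S k <= n -> bounded_closed k.
Proof.
  induction k; intro; [apply bounded_closed_zero|].
  apply bounded_closed_succ; auto; apply IHk; lia.
Qed.

(** Induction on the common-bound predicate [E] is possible at level [n] itself: [E] requires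
    bounded closure only one level lower, and progressiveness, being valid in all models, needs no
    disjunct in the induction formula. *)
Lemma strong_IR y R :
  Sigma n R ->
  (forall M, model M -> forall rho,
     (forall d, lt d (rho y) -> R M (upd rho y d)) -> R M rho) ->
  forall M, model M -> forall rho, R M rho.
Proof.
  intros [phi [H D]] HP.
  set (j := bound phi + y + 2).
  destruct (bounded_witness n phi y j) as [E [SE HE]]; auto.
  { clear H; assert (A := bounded_closed_below); destruct n; auto. }
  assert (W : forall M, model M -> forall rho, E M rho).
  { apply (IR_pred j); auto.
    - intros M HM rho; apply HE; auto; apply (D M HM), (HP M HM).
      intros d Hd; rewrite upd_same in Hd; now apply not_lt_zero in Hd.
    - intros M HM rho K; apply HE; auto; apply (D M HM), (HP M HM).
      intros d Hd; rewrite upd_same in Hd; rewrite upd_shadow.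
      apply (D M HM), (HE M HM); auto; now apply lt_succ. }
  intros M HM rho; pose proof (proj1 (HE M HM _) (W M HM (upd rho j (rho y))) (rho y)) as K.
  rewrite upd_same in K; specialize (K (le_refl M HM _)).
  rewrite upd_comm, upd_id in K by lia.
  apply (D M HM); revert K; apply sat_fresh; lia.
Qed.

(** * Induction on several variables *)

Definition progressive (Y : list var) (R : pred) : Prop :=
  forall M, model M -> forall rho,
    (forall y d, In y Y -> lt d (rho y) -> R M (upd rho y d)) -> R M rho.

(** The universal form in [merge_spec] would put [R] under bounded universal quantifiers, where
    [Sigma n] may be lost. Since a code has at most one decoding, the existential form is
    equivalent, with a separate disjunct for values coding no pair. *)
Definition merge (w y1 y2 : var) (R : pred) : pred :=
  let eqn := Eq (Var w) (Add (Mul (Add (Var y1) (Var y2)) (Add (Var y1) (Var y2))) (Var y1)) in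
  por (ball y1 w (ball y2 w (pnot (fun M rho => sat M rho eqn))))
      (bex y1 w (bex y2 w (pand (fun M rho => sat M rho eqn) R))).

Lemma merge_spec M (HM : model M) w y1 y2 R rho :
  w <> y1 -> w <> y2 -> y1 <> y2 ->
  merge w y1 y2 R M rho <->
  forall a b, rho w = pair M a b -> R M (upd (upd rho y1 a) y2 b).
Proof.
  intros N1 N2 N; unfold merge, por, ball, bex, pnot, pand; simpl.
  assert (E : forall a b,
    upd (upd rho y1 a) y2 b w = rho w /\
    upd (upd rho y1 a) y2 b y1 = a /\ upd (upd rho y1 a) y2 b y2 = b).
  { intros a b; rewrite upd_same, (upd_other _ w), (upd_other _ w), (upd_other _ y1),
      upd_same by auto; auto. }
  split.
  - intros [K|[a' [_ [b' [_ [K L]]]]]] a b H.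
    + exfalso; apply (K a) with b.
      * rewrite H; now apply le_pair_l.
      * rewrite upd_other, H by auto; now apply le_pair_r.
      * destruct (E a b) as [-> [-> ->]]; auto.
    + destruct (E a' b') as [E1 [E2 E3]]; rewrite E1, E2, E3, H in K.
      now apply pair_inj in K as [-> ->].
  - intro K; destruct (classic (exists a b, rho w = pair M a b)) as [[a [b H]]|H].
    + right; exists a; split; [rewrite H; now apply le_pair_l|].
      exists b; split; [rewrite upd_other, H by auto; now apply le_pair_r|].
      split; auto; destruct (E a b) as [-> [-> ->]]; auto.
    + left; intros a _ b _; destruct (E a b) as [-> [-> ->]]; eauto.
Qed.

(** Two variables are replaced by a fresh one holding the code of their values. Lowering either
    component lowers the code, so progressiveness survives while the list gets shorter. *)
Lemma progressive_IR Y R :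
  NoDup Y -> Sigma n R -> progressive Y R -> forall M, model M -> forall rho, R M rho.
Proof.
  remember (length Y) as len eqn:HL; revert Y R HL.
  induction len as [|len IH]; intros Y R HL ND SR HP.
  - destruct Y; [|easy]; intros M HM rho; apply HP; simpl; auto; easy.
  - destruct Y as [|y1 [|y2 Y]]; [easy| |].
    + apply (strong_IR y1); auto; intros M HM rho K; apply HP; auto.
      intros y d [<-|[]]; auto.
    + inversion ND as [|? ? NI1 ND1]; subst; inversion ND1 as [|? ? NI2 ND2]; subst.
      assert (N : y1 <> y2) by (intro; apply NI1; now left).
      destruct SR as [phi [H D]].
      set (w := bound phi + list_max (y1 :: y2 :: Y) + 1).
      assert (Nw : forall y, In y (y1 :: y2 :: Y) -> y < w).
      { intros y Hy; pose proof (proj1 (list_max_le (y1 :: y2 :: Y) _) (le_n _)) as F.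
        rewrite Forall_forall in F; apply F in Hy; lia. }
      assert (N1 : y1 < w) by (apply Nw; simpl; auto).
      assert (N2 : y2 < w) by (apply Nw; simpl; auto).
      assert (F : forall M rho a, model M -> R M (upd rho w a) <-> R M rho).
      { intros M rho a HM; rewrite !(D M HM); apply sat_fresh; lia. }
      assert (S' : forall M, model M -> forall rho, merge w y1 y2 R M rho).
      { apply (IH (w :: Y)).
        - simpl in *; lia.
        - constructor; auto; intro K; specialize (Nw w); simpl in Nw; intuition lia.
        - unfold merge; set (eqn := Eq _ _).
          assert (Se : Sigma 0 (fun M rho => sat M rho eqn))
            by (exists eqn; split; [repeat constructor|]; intros M HM rho; reflexivity).
          apply Sigma_or.
          + apply (Sigma_mono 0); [lia|].
            apply bounded_closed_zero; [lia|]; apply bounded_closed_zero; [lia|].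
            now apply Sigma_not, Sigma0_Pi0.
          + apply Sigma_bex; [lia|]; apply Sigma_bex; [lia|]; apply Sigma_and.
            * apply (Sigma_mono 0); auto; lia.
            * now exists phi.
        - intros M HM rho K; apply merge_spec; auto; try lia; intros a b Hab.
          apply HP; auto; intros y d [<-|[<-|Hy]] Hd.
          + rewrite upd_other, upd_same in Hd by auto.
            rewrite (upd_comm (upd rho y1 a)), upd_shadow by auto.
            assert (L : lt (pair M d b) (rho w)) by (rewrite Hab; now apply pair_lt_l).
            apply (K w) in L; [|now left].
            apply merge_spec with (a := d) (b := b) in L; auto; try lia.
            * rewrite !(upd_comm _ w) in L by lia; now apply F in L.
            * now rewrite upd_same.
          + rewrite upd_same in Hd; rewrite upd_shadow.
            assert (L : lt (pair M a d) (rho w)) by (rewrite Hab; now apply pair_lt_r).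
            apply (K w) in L; [|now left].
            apply merge_spec with (a := a) (b := d) in L; auto; try lia.
            * rewrite !(upd_comm _ w) in L by lia; now apply F in L.
            * now rewrite upd_same.
          + assert (y <> y1) by (intro; subst; apply NI1; now right).
            assert (y <> y2) by (intro; subst; auto).
            assert (y < w) by (apply Nw; simpl; auto).
            rewrite !upd_other in Hd by auto.
            apply (K y) in Hd; [|now right].
            apply merge_spec with (a := a) (b := b) in Hd; auto; try lia.
            * now rewrite !(upd_comm _ y) in Hd by auto.
            * rewrite upd_other; auto; lia. }
      intros M HM rho.
      pose proof (S' M HM (upd rho w (pair M (rho y1) (rho y2)))) as K.
      apply merge_spec with (a := rho y1) (b := rho y2) in K; auto; try lia.
      * rewrite !(upd_comm _ w) in K by lia; apply F in K; auto.
        now rewrite upd_id, upd_id in K.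
      * now rewrite upd_same.
Qed.

End Induction.

(** * Soundness of infinite proofs *)

Definition refutes (M : structure) (rho : var -> M) (G : sequent) : Prop :=
  Forall (fun phi => ~ sat M rho phi) G.

Lemma sat_bigor M rho G : sat M rho (bigor G) <-> ~ refutes M rho G.
Proof.
  unfold refutes; induction G as [|phi [|psi G] IH].
  - simpl; split; [tauto|intro H; destruct H; constructor].
  - simpl; rewrite Forall_cons_iff, Forall_nil_iff; tauto.
  - change (sat M rho phi \/ sat M rho (bigor (psi :: G)) <->
            ~ refutes M rho (phi :: psi :: G)).
    unfold refutes in *; rewrite IH, (Forall_cons_iff _ phi); tauto.
Qed.

Lemma refutes_perm M rho G G' :
  Permutation G G' -> refutes M rho G <-> refutes M rho G'.
Proof.
  intro H; unfold refutes; rewrite !Forall_forall.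
  split; intros K phi Hphi; apply K; revert Hphi; apply Permutation_in; auto.
  now apply Permutation_sym.
Qed.

Lemma refutes_subst M rho y t G :
  (forall phi, free_for t y phi) ->
  refutes M rho (map (subst y t) G) <-> refutes M (upd rho y (eval M rho t)) G.
Proof.
  intro F; unfold refutes; rewrite Forall_map, !Forall_forall.
  split; intros H phi K L; apply (H phi K); now apply sat_subst.
Qed.

Definition seq_connectives (G : sequent) : nat := list_sum (map connectives G).

Lemma seq_connectives_perm G G' :
  Permutation G G' -> seq_connectives G = seq_connectives G'.
Proof.
  unfold seq_connectives; induction 1; simpl; lia.
Qed.

(** * Local soundness of the rules *)

Section Soundness.

Context (n : nat) (T : formula -> Prop).

Let U (phi : formula) : Prop := Q_axiom phi \/ T phi.
Let HQ : forall phi, Q_axiom phi -> U phi := fun phi H => or_introl H.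

Notation model := (model_of (theorem_IR U n)).

Definition valid (G : sequent) : Prop :=
  forall M, model M -> forall rho, ~ refutes M rho G.

Lemma inference_pointwise r G Ps :
  inference T r G Ps ->
  (forall y phi z, r <> RAll y phi z) -> (forall y, r <> RCase y) ->
  forall M, model M -> forall rho, refutes M rho G ->
  exists i G', nth_error Ps i = Some G' /\ refutes M rho G'.
Proof.
  intros H NA NC M HM rho R.
  assert (one : forall G', Ps = [G'] -> refutes M rho G' ->
    exists i G', nth_error Ps i = Some G' /\ refutes M rho G').
  { intros G' -> K; exists 0, G'; auto. }
  unfold refutes in R.
  destruct H; rewrite ?Forall_cons_iff in R; simpl in R.
  - tauto.
  - destruct R as [R _]; destruct R; now apply (succ_nonzero U n HQ).
  - destruct R as [R _]; destruct R; apply HM, th_axiom; now right.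
  - destruct R as [R RG]; apply not_and_or in R as [R|R].
    + exists 0, (phi :: G); split; auto; now constructor.
    + exists 1, (psi :: G); split; auto; now constructor.
  - eapply one; [reflexivity|]; repeat constructor; tauto.
  - now destruct (NA y phi z).
  - eapply one; [reflexivity|]; destruct R as [R RG]; repeat constructor; auto.
    intro K; apply R; apply sat_subst in K; eauto.
  - eapply one; [reflexivity|]; constructor; auto.
  - eapply one; [reflexivity|]; destruct R as [R0 [R1 RG]].
    repeat constructor; auto; simpl; rewrite !eval_subst in *.
    apply NNPP in R0; now rewrite <- R0.
  - eapply one; [reflexivity|]; constructor; auto; simpl.
    rewrite (add_zero_r U n HQ); auto.
  - eapply one; [reflexivity|]; constructor; auto; simpl.
    rewrite (add_succ_r U n HQ); auto.
  - eapply one; [reflexivity|]; constructor; auto; simpl.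
    rewrite (mul_zero_r U n HQ); auto.
  - eapply one; [reflexivity|]; constructor; auto; simpl.
    rewrite (mul_succ_r U n HQ); auto.
  - eapply one; [reflexivity|]; destruct R as [R RG]; repeat constructor; auto; simpl.
    intro K; apply R; intro E; apply K; revert E; now apply (succ_inj U n HQ).
  - now destruct (NC y).
  - eapply one; [reflexivity|]; now apply Forall_app in R.
  - destruct (classic (sat M rho phi)) as [K|K].
    + exists 1, (neg phi :: G); split; auto; constructor; auto.
      now rewrite sat_neg.
    + exists 0, (phi :: G); split; auto; now constructor.
Qed.

(** The source of all descent: passing to the right premiss replaces the value of [y] by its
    predecessor. *)
Lemma inference_case y G Ps :
  inference T (RCase y) G Ps ->
  forall M, model M -> forall rho, refutes M rho G ->
  (exists G', nth_error Ps 0 = Some G' /\ refutes M rho G') \/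
  (exists d G', rho y = succ d /\ nth_error Ps 1 = Some G' /\
     refutes M (upd rho y d) G').
Proof.
  intros H M HM rho R; inversion H; subst.
  destruct (zero_or_succ U n HQ M HM (rho y)) as [E|[d E]].
  - left; eexists; split; [reflexivity|].
    apply refutes_subst; [intro; apply free_for_closed; auto|].
    simpl; now rewrite <- E, upd_id.
  - right; exists d; eexists; split; [auto|split; [reflexivity|]].
    apply refutes_subst; [intro; apply free_for_own; auto|].
    simpl; now rewrite upd_same, <- E, upd_shadow, upd_id.
Qed.

Lemma inference_all y phi z G Ps :
  inference T (RAll y phi z) G Ps ->
  forall (M : structure) (rho : var -> M), refutes M rho G ->
  exists d G', nth_error Ps 0 = Some G' /\ refutes M (upd rho z d) G'.
Proof.
  intros H M rho R; inversion H; subst.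
  apply Forall_cons_iff in R as [R RG]; simpl in R.
  apply not_all_ex_not in R as [d R]; exists d; eexists; split; [reflexivity|].
  assert (NF : forall psi, In psi (All y phi :: G0) -> ~ free_in z psi).
  { intros psi Hpsi K.
    match goal with F : ~ free_in_seq _ _ |- _ => apply F end.
    apply Exists_exists; eauto. }
  constructor.
  - intro K; apply R; apply sat_subst in K; auto; simpl in K.
    rewrite upd_same in K; revert K; apply sat_ext; intros x Hx; unfold upd.
    destruct (Nat.eqb_spec x y), (Nat.eqb_spec x z); auto; subst.
    exfalso; apply (NF (All y phi)); simpl; auto.
  - rewrite Forall_forall in *; intros psi Hpsi K; apply (RG psi Hpsi).
    revert K; apply sat_ext; intros x Hx; symmetry; apply upd_other.
    intros ->; apply (NF psi); simpl; auto.
Qed.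

Lemma inference_valid r G Ps :
  inference T r G Ps -> ~ valid G ->
  exists i G', nth_error Ps i = Some G' /\ ~ valid G'.
Proof.
  intros H NV.
  apply not_all_ex_not in NV as [M NV]; apply imply_to_and in NV as [HM NV].
  apply not_all_ex_not in NV as [rho NV]; apply NNPP in NV.
  assert (nonvalid : forall rho G', refutes M rho G' -> ~ valid G').
  { intros rho' G' R V; now apply (V M HM rho'). }
  destruct (classic (exists y phi z, r = RAll y phi z)) as [[y [phi [z ->]]]|NA].
  { eapply inference_all in H as [d [G' [E R]]]; eauto. }
  destruct (classic (exists y, r = RCase y)) as [[y ->]|NC].
  { eapply inference_case in H as [[G' [E R]]|[d [G' [_ [E R]]]]]; eauto. }
  destruct (inference_pointwise r G Ps H) with (M := M) (rho := rho)
    as [i [G' [E R]]]; eauto.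
  intros y phi z ->; apply NA; eauto.
Qed.

(** * Nodes up to isomorphism of their subtrees *)

Context (P : marked_tree) (hb : built_by_rules T P) (hr : sigma_restricted n P).

Definition refuted (M : structure) (rho : var -> M) (a : address) : Prop :=
  exists G, mark P a = Some G /\ refutes M rho G.

Definition invalid (a : address) : Prop :=
  exists G, mark P a = Some G /\ ~ valid G.

(** Refers to marks only, so that it transfers between isomorphic subtrees. *)
Definition case_node (a : address) : Prop :=
  exists G G', mark P a = Some G /\ mark P (a ++ [1]) = Some G' /\
    length G' = length G /\ seq_connectives G' = seq_connectives G.

Notation iso := (isomorphic_subtrees P).

Lemma same_mark_sym m m' : same_mark m m' -> same_mark m' m.
Proof. destruct m, m'; simpl; auto; now apply Permutation_sym. Qed.

Lemma same_mark_trans m m' m'' :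
  same_mark m m' -> same_mark m' m'' -> same_mark m m''.
Proof. destruct m, m', m''; simpl; try tauto; apply Permutation_trans. Qed.

Lemma same_mark_some m m' G :
  same_mark m m' -> m = Some G -> exists G', m' = Some G' /\ Permutation G G'.
Proof. intros H ->; destruct m' as [G'|]; [|easy]; now exists G'. Qed.

Lemma iso_refl a : iso a a.
Proof. intro c; destruct (mark P (a ++ c)); simpl; auto. Qed.

Lemma iso_sym a a' : iso a a' -> iso a' a.
Proof. intros H c; now apply same_mark_sym. Qed.

Lemma iso_trans a a' a'' : iso a a' -> iso a' a'' -> iso a a''.
Proof. intros H K c; now apply same_mark_trans with (mark P (a' ++ c)). Qed.

Lemma iso_app a a' c : iso a a' -> iso (a ++ c) (a' ++ c).
Proof. intros H d; rewrite <- !app_assoc; apply H. Qed.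

Lemma iso_mark a a' G :
  iso a a' -> mark P a = Some G -> exists G', mark P a' = Some G' /\ Permutation G G'.
Proof.
  intros H; apply same_mark_some; specialize (H []); now rewrite !app_nil_r in H.
Qed.

Lemma refuted_iso M rho a a' : iso a a' -> refuted M rho a -> refuted M rho a'.
Proof.
  intros H [G [E R]]; destruct (iso_mark a a' G H E) as [G' [E' K]].
  exists G'; split; auto; now apply (refutes_perm M rho G G').
Qed.

Lemma invalid_refuted a : invalid a <-> exists M rho, model M /\ refuted M rho a.
Proof.
  split.
  - intros [G [E NV]].
    apply not_all_ex_not in NV as [M NV]; apply imply_to_and in NV as [HM NV].
    apply not_all_ex_not in NV as [rho NV]; apply NNPP in NV.
    exists M, rho; split; auto; now exists G.
  - intros [M [rho [HM [G [E R]]]]]; exists G; split; auto.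
    intro V; now apply (V M HM rho).
Qed.

Lemma invalid_iso a a' : iso a a' -> invalid a -> invalid a'.
Proof.
  intros H K; apply invalid_refuted in K as [M [rho [HM K]]].
  apply invalid_refuted; exists M, rho; split; auto; revert K; now apply refuted_iso.
Qed.

Lemma case_node_iso a a' : iso a a' -> case_node a -> case_node a'.
Proof.
  intros H [G [G1 [E [E1 [L C]]]]].
  destruct (iso_mark _ _ _ H E) as [G' [E' K]].
  destruct (iso_mark _ _ _ (iso_app _ _ [1] H) E1) as [G1' [E1' K1]].
  exists G', G1'; repeat split; auto.
  - now rewrite <- (Permutation_length K), <- (Permutation_length K1).
  - now rewrite <- (seq_connectives_perm _ _ K), <- (seq_connectives_perm _ _ K1).
Qed.

Lemma built a G :
  mark P a = Some G ->
  exists G' Ps, Permutation G G' /\ inference T (rule_at P a) G' Ps /\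
    forall i, same_mark (mark P (a ++ [i])) (nth_error Ps i).
Proof. apply hb. Qed.

Lemma marked_prefix a c : mark P (a ++ c) <> None -> mark P a <> None.
Proof.
  induction c as [|i c IH] using rev_ind; [now rewrite app_nil_r|].
  intros H K; apply H; rewrite app_assoc; apply hb.
  destruct (mark P (a ++ c)); auto; exfalso; apply IH; auto; discriminate.
Qed.

Lemma premiss_mark a Ps i G :
  (forall i, same_mark (mark P (a ++ [i])) (nth_error Ps i)) ->
  nth_error Ps i = Some G ->
  exists G', mark P (a ++ [i]) = Some G' /\ Permutation G G'.
Proof.
  intros H E; now apply (same_mark_some _ _ _ (same_mark_sym _ _ (H i))).
Qed.

Lemma premiss_refuted a Ps i G M rho :
  (forall i, same_mark (mark P (a ++ [i])) (nth_error Ps i)) ->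
  nth_error Ps i = Some G -> refutes M rho G -> refuted M rho (a ++ [i]).
Proof.
  intros H E R; destruct (premiss_mark a Ps i G H E) as [G' [E' K]].
  exists G'; split; auto; now apply (refutes_perm M rho G G').
Qed.

Lemma invalid_child a : invalid a -> exists i, invalid (a ++ [i]).
Proof.
  intros [G [E NV]]; destruct (built a G E) as [G' [Ps [K [I H]]]].
  destruct (inference_valid _ _ _ I) as [i [G1 [E1 NV1]]].
  - intro V; apply NV; intros M HM rho R; apply (V M HM rho).
    now apply (refutes_perm M rho G G').
  - exists i; destruct (premiss_mark a Ps i G1 H E1) as [G2 [E2 K2]].
    exists G2; split; auto; intro V; apply NV1; intros M HM rho R.
    apply (V M HM rho); now apply (refutes_perm M rho G1 G2).
Qed.

(** The rule marking of isomorphic subtrees may differ, but whether the rule is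
    (case) can be read off the sequents: it is the only binary rule preserving
    both the number of formulas and the number of connectives. *)
Lemma case_node_rule a :
  mark P a <> None -> case_node a <-> exists y, rule_at P a = RCase y.
Proof.
  intro Ha; destruct (mark P a) as [G|] eqn:E; [clear Ha|easy].
  destruct (built a G E) as [G' [Ps [K [I H]]]].
  split.
  - intros [G0 [G1 [E0 [E1 [L C]]]]]; rewrite E in E0; injection E0 as <-.
    destruct (same_mark_some _ _ _ (H 1) E1) as [G2 [E2 K2]].
    rewrite (Permutation_length K), (Permutation_length K2) in L.
    rewrite (seq_connectives_perm _ _ K), (seq_connectives_perm _ _ K2) in C.
    (* Only binary rules have a premiss of index 1: (and) loses a connective, (cut) gains a
       formula. *)
    destruct I; try discriminate E2; injection E2 as <-.
    + unfold seq_connectives in C; simpl in C; lia.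
    + now exists y.
    + simpl in L; lia.
  - intros [y Ey]; rewrite Ey in I; inversion I; subst.
    destruct (premiss_mark a _ 1 _ H eq_refl) as [G2 [E2 K2]].
    exists G, G2; repeat split; auto.
    + now rewrite <- (Permutation_length K2), length_map, (Permutation_length K).
    + rewrite <- (seq_connectives_perm _ _ K2), (seq_connectives_perm _ _ K).
      unfold seq_connectives; rewrite map_map; f_equal; apply map_ext.
      intro; apply connectives_subst.
Qed.

(** * Paths of invalid nodes *)

Fixpoint invalid_path (a p : address) : Prop :=
  invalid a /\ match p with [] => True | i :: p => invalid_path (a ++ [i]) p end.

Lemma invalid_path_app a p q :
  invalid_path a (p ++ q) <-> invalid_path a p /\ invalid_path (a ++ p) q.
Proof.
  revert a; induction p as [|i p IH]; intro a; simpl.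
  - rewrite app_nil_r; split; [|tauto]; intro H; split; auto.
    destruct q; simpl in H; tauto.
  - rewrite IH, <- app_assoc; simpl; tauto.
Qed.

Lemma invalid_path_end a p : invalid_path a p -> invalid (a ++ p).
Proof.
  intro H; rewrite <- (app_nil_r p) in H; apply invalid_path_app in H as [_ H].
  apply H.
Qed.

Lemma invalid_path_snoc a p i :
  invalid_path a p -> invalid (a ++ p ++ [i]) -> invalid_path a (p ++ [i]).
Proof.
  intros H K; apply invalid_path_app; split; auto; simpl.
  rewrite <- app_assoc; split; [now apply invalid_path_end|]; split; auto.
Qed.

Lemma invalid_marked a : invalid a -> mark P a <> None.
Proof. intros [G [-> _]]; discriminate. Qed.

Lemma invalid_path_extend a p :
  invalid_path a p -> exists i, invalid_path a (p ++ [i]).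
Proof.
  intro H; destruct (invalid_child _ (invalid_path_end _ _ H)) as [i Hi].
  exists i; apply invalid_path_snoc; auto; now rewrite app_assoc.
Qed.

(** A recurrent node lies in a terminal strongly connected component of the
    finite graph of invalid nodes up to isomorphism. *)
Definition recurrent (a : address) : Prop :=
  invalid a /\
  forall p, invalid_path a p ->
    exists q, invalid_path (a ++ p) q /\ iso (a ++ p ++ q) a.

(** If [a] is not recurrent, some path leads to a node from which no copy of [a] can be reached any
    more. Continuing from there, the representative of [a] can be removed from [L]. *)
Lemma recurrent_exists_in L : forall a,
  invalid a ->
  (forall p, invalid_path a p -> exists c, In c L /\ iso (a ++ p) c) ->
  exists a', recurrent a'.
Proof.
  remember (length L) as m eqn:Hm; revert L Hm.
  induction m as [|m IH]; intros L Hm a Ha HL.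
  - destruct (HL []) as [c [Hc _]]; [now simpl|].
    destruct L; [easy|discriminate].
  - destruct (classic (recurrent a)) as [R|R]; [now exists a|].
    apply not_and_or in R as [R|R]; [easy|].
    apply not_all_ex_not in R as [p R]; apply imply_to_and in R as [Hp R].
    destruct (HL []) as [c [Hc Hac]]; [now simpl|].
    rewrite app_nil_r in Hac.
    apply in_split in Hc as [L1 [L2 ->]].
    apply (IH (L1 ++ L2)) with (a ++ p).
    + rewrite length_app in *; simpl in Hm; lia.
    + now apply invalid_path_end.
    + intros q Hq; destruct (HL (p ++ q)) as [c' [Hc' I]].
      { now apply invalid_path_app. }
      exists c'; rewrite <- app_assoc; split; auto.
      apply in_app_iff in Hc' as [Hc'|[<-|Hc']]; apply in_app_iff; auto.
      exfalso; apply R; exists q; split; auto.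
      now apply iso_trans with c; [|apply iso_sym].
Qed.

Lemma recurrent_exists a : regular P -> invalid a -> exists a', recurrent a'.
Proof.
  intros [L HL] Ha; apply (recurrent_exists_in L a Ha).
  intros p Hp; apply HL, invalid_marked; now apply invalid_path_end.
Qed.

(** * Branches as limits of growing addresses *)

Lemma node_succ b k : node b (S k) = node b k ++ [b k].
Proof. unfold node; now rewrite seq_S, map_app. Qed.

Lemma limit_branch (s : nat -> address) :
  (forall j, exists i c, s (S j) = s j ++ i :: c) ->
  exists b, forall j a c, s j = a ++ c -> node b (length a) = a.
Proof.
  intro H.
  assert (mono : forall d j, exists c, s (d + j) = s j ++ c).
  { induction d as [|d IH]; intro j; [exists []; now rewrite app_nil_r|].
    destruct (IH j) as [c E], (H (d + j)) as [i [c' E']].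
    exists (c ++ i :: c'); simpl; now rewrite E', E, app_assoc. }
  assert (len : forall j, j <= length (s j)).
  { induction j as [|j IH]; [lia|]; destruct (H j) as [i [c E]].
    rewrite E, length_app; simpl; lia. }
  (* [s (S k)] has more than [k] entries, so the default 0 is never returned. *)
  exists (fun k => nth k (s (S k)) 0).
  assert (E : forall k j, k < length (s j) -> nth k (s (S k)) 0 = nth k (s j) 0).
  { intros k j Hk; pose proof (len (S k)).
    destruct (mono j (S k)) as [c E1], (mono (S k) j) as [c' E2].
    rewrite Nat.add_comm, E1 in E2.
    rewrite <- (app_nth1 (s (S k)) c), E2, app_nth1; auto. }
  intros j a; induction a as [|i a IH] using rev_ind; intros c Hs; [easy|].
  rewrite length_app, Nat.add_1_r, node_succ; simpl.
  rewrite (IH (i :: c)); [|now rewrite Hs, <- app_assoc].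
  rewrite (E _ j), Hs, <- app_assoc, app_nth2, Nat.sub_diag; auto.
  rewrite Hs, !length_app; simpl; lia.
Qed.

Lemma branch_marked b :
  (forall k, exists m, k <= m /\ mark P (node b m) <> None) -> infinite_branch P b.
Proof.
  intros H k; destruct (H k) as [m [L K]]; revert K.
  replace m with ((m - k) + k) by lia; generalize (m - k) as d.
  induction d as [|d IH]; auto.
  simpl Nat.add; rewrite node_succ; intro K; apply IH; revert K; apply marked_prefix.
Qed.

(** * Refutations inside a terminal component *)

Section Recurrent.

Context (a0 : address) (ha0 : recurrent a0).

(** The node reached by [p] lies on a loop, hence on a periodic branch whose
    tail satisfies the Sigma_n-restriction. *)
Lemma loop_rule p i :
  invalid_path a0 (p ++ [i]) ->
  exists a, iso a (a0 ++ p) /\ mark P a <> None /\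
    (forall y phi z, rule_at P a <> RAll y phi z) /\
    (forall y, rule_at P a = RCase y ->
       i <> 0 /\ (i = 1 -> forall G, mark P a = Some G -> Forall (is_sigma n) G)).
Proof.
  intro Hp; destruct (proj2 ha0 _ Hp) as [q [Hq Iq]].
  set (l := p ++ i :: q).
  assert (El : (p ++ [i]) ++ q = l) by (unfold l; now rewrite <- app_assoc).
  assert (Hl : invalid_path a0 l) by (rewrite <- El; now apply invalid_path_app).
  rewrite El in Iq.
  set (s := fix s j := match j with 0 => a0 | S j => s j ++ l end).
  assert (Is : forall j, iso (s j) a0).
  { induction j as [|j IH]; [apply iso_refl|].
    apply iso_trans with (a0 ++ l); auto; now apply iso_app. }
  destruct (limit_branch s) as [b Hb].
  { intro j; simpl; unfold l; destruct p as [|i' p']; simpl; eauto. }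
  assert (Hn : forall j, node b (length (s j)) = s j).
  { intro j; apply (Hb j (s j) []); now rewrite app_nil_r. }
  assert (len : forall j, j <= length (s j)).
  { induction j as [|j IH]; [lia|]; simpl; rewrite length_app; unfold l.
    rewrite length_app; simpl; lia. }
  assert (br : infinite_branch P b).
  { apply branch_marked; intro k; exists (length (s k)); split; auto.
    rewrite Hn; apply invalid_marked, (invalid_iso a0); [now apply iso_sym|apply ha0]. }
  destruct (hr b br) as [N [ca [_ [_ [_ [ce [_ cg]]]]]]].
  (* After [N] turns of the loop the tail has begun. The conclusion is about this copy of [a0 ++ p],
     since the restriction says nothing before the tail and [rule_at] may differ between copies. *)
  set (a := s N ++ p).
  assert (Ha : node b (length a) = a).
  { apply (Hb (S N) a (i :: q)); simpl; unfold a, l; now rewrite <- app_assoc. }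
  assert (Hi : b (length a) = i).
  { assert (E : node b (length (a ++ [i])) = a ++ [i]).
    { apply (Hb (S N) _ q); simpl; unfold a, l; now rewrite <- !app_assoc. }
    rewrite length_app, Nat.add_1_r, node_succ, Ha in E.
    now apply app_inj_tail in E as [_ E]. }
  assert (HN : N <= length a) by (unfold a; rewrite length_app; specialize (len N); lia).
  exists a; split; [now apply iso_app|]; split; [rewrite <- Ha; apply br|]; split.
  - intros y phi z; rewrite <- Ha; now apply ce.
  - intros y Hy; split.
    + intros ->; apply (ca y (length a)); repeat split; auto; now rewrite Ha.
    + intros -> G HG; apply (cg y (length a)); [|now rewrite Ha].
      repeat split; auto; now rewrite Ha.
Qed.

Lemma refuted_path p M rho :
  model M -> invalid_path a0 p ->
  forall i, refuted M rho (a0 ++ p ++ [i]) -> invalid_path a0 (p ++ [i]).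
Proof.
  intros HM H i R; apply invalid_path_snoc; auto.
  apply invalid_refuted; now exists M, rho.
Qed.

Lemma refuted_child p :
  invalid_path a0 p -> ~ case_node (a0 ++ p) ->
  forall M, model M -> forall rho, refuted M rho (a0 ++ p) ->
  exists i, refuted M rho (a0 ++ p ++ [i]).
Proof.
  intros Hp NC M HM rho R.
  destruct (invalid_path_extend _ _ Hp) as [i0 Hi0].
  destruct (loop_rule p i0 Hi0) as [a [Ia [Ma [NA _]]]].
  apply (refuted_iso M rho _ a (iso_sym _ _ Ia)) in R as [G [E R]].
  destruct (built a G E) as [G' [Ps [K [I H]]]].
  apply (refutes_perm M rho G G' K) in R.
  destruct (inference_pointwise _ _ _ I NA) with (M := M) (rho := rho)
    as [i [G1 [E1 R1]]]; auto.
  - intros y Hy; apply NC, (case_node_iso a); auto.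
    apply case_node_rule; auto; now exists y.
  - exists i; rewrite app_assoc; apply (refuted_iso M rho (a ++ [i])).
    + now apply iso_app.
    + now apply (premiss_refuted a Ps i G1).
Qed.

Definition case_step (y : var) (p : address) : Prop :=
  forall M, model M -> forall rho, refuted M rho (a0 ++ p) ->
  exists d, rho y = succ d /\ refuted M (upd rho y d) (a0 ++ p ++ [1]).

Lemma case_node_sigma p :
  invalid_path a0 p -> case_node (a0 ++ p) ->
  (exists G, mark P (a0 ++ p) = Some G /\ Forall (is_sigma n) G) /\
  exists y, case_step y p.
Proof.
  intros Hp C.
  assert (rule : forall i, invalid_path a0 (p ++ [i]) -> exists a y,
    iso a (a0 ++ p) /\ mark P a <> None /\ rule_at P a = RCase y /\ i <> 0 /\
    (i = 1 -> forall G, mark P a = Some G -> Forall (is_sigma n) G)).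
  { intros i Hi; destruct (loop_rule p i Hi) as [a [Ia [Ma [_ K]]]].
    destruct (proj1 (case_node_rule a Ma)) as [y Hy].
    { revert C; apply case_node_iso; now apply iso_sym. }
    exists a, y; destruct (K y Hy); auto. }
  destruct (invalid_path_extend _ _ Hp) as [i Hi].
  destruct (rule i Hi) as [a [y [Ia [Ma [Ra [Ni Si]]]]]].
  destruct (mark P a) as [G|] eqn:E; [|easy].
  destruct (built a G E) as [G' [Ps [K [I H]]]]; rewrite Ra in I.
  split.
  - destruct (iso_mark _ _ _ Ia E) as [G1 [E1 K1]].
    exists G1; split; auto.
    assert (Forall (is_sigma n) G) as F.
    { apply Si; auto.
      apply invalid_path_end, invalid_marked in Hi.
      pose proof (iso_app _ _ [i] Ia []) as J; rewrite !app_nil_r, <- app_assoc in J.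
      specialize (H i); inversion I; subst.
      (* An application of (case) has no premiss beyond index 1, and index 0 is already excluded. *)
      destruct i as [|[|i]]; [easy|easy|].
      simpl in H; destruct i; simpl in H;
        destruct (mark P (a ++ _)); try easy;
        destruct (mark P (a0 ++ p ++ _)); easy. }
    rewrite Forall_forall in *; intros phi Hphi; apply F.
    revert Hphi; apply Permutation_in; now apply Permutation_sym.
  - exists y; intros M HM rho R.
    apply (refuted_iso M rho _ a (iso_sym _ _ Ia)) in R as [G1 [E1 R]].
    rewrite E in E1; injection E1 as <-; apply (refutes_perm M rho G G' K) in R.
    destruct (inference_case _ _ _ I M HM rho R) as [[G1 [E1 R1]]|[d [G1 [Ed [E1 R1]]]]].
    (* A refuted left premiss would continue the path within the component, where the periodic
       branch through it contradicts condition (a). *)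
    + exfalso.
      apply (premiss_refuted a Ps 0 G1) in R1; auto.
      apply (refuted_iso M rho _ _ (iso_app _ _ [0] Ia)) in R1.
      rewrite <- app_assoc in R1; apply (refuted_path p) in R1; auto.
      destruct (rule 0 R1) as [a' [y' [_ [_ [_ [N0 _]]]]]]; now apply N0.
    + exists d; split; auto; rewrite app_assoc.
      apply (refuted_iso M _ _ _ (iso_app _ _ [1] Ia)).
      now apply (premiss_refuted a Ps 1 G1).
Qed.

(** Otherwise dependent choice extends [p] forever through nodes refuted by the same assignment, and
    the resulting branch meets no (case) from [p] on, against condition (c). *)
Lemma refuted_case_node p M rho :
  model M -> invalid_path a0 p -> refuted M rho (a0 ++ p) ->
  exists q, invalid_path a0 q /\ case_node (a0 ++ q) /\ refuted M rho (a0 ++ q).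
Proof.
  intros HM Hp R; apply NNPP; intro NE.
  set (A := fun q => invalid_path a0 q /\ refuted M rho (a0 ++ q)).
  assert (step : forall q : {q | A q}, exists i, A (proj1_sig q ++ [i])).
  { intros [q [Hq Rq]]; simpl.
    destruct (refuted_child q Hq) with (M := M) (rho := rho) as [i Hi]; auto.
    { intro C; apply NE; now exists q. }
    exists i; split; auto; now apply (refuted_path q M rho). }
  assert (chain : exists s : nat -> {q | A q}, proj1_sig (s 0) = p /\
    forall j, exists i, proj1_sig (s (S j)) = proj1_sig (s j) ++ [i]).
  { exists (nat_rect _ (exist A p (conj Hp R)) (fun _ q =>
      let (i, Hi) := constructive_indefinite_description _ (step q) in
      exist A (proj1_sig q ++ [i]) Hi)).
    split; auto; intro j; simpl.
    destruct (constructive_indefinite_description _ _) as [i Hi]; now exists i. }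
  destruct chain as [s [s0 sS]].
  destruct (limit_branch (fun j => a0 ++ proj1_sig (s j))) as [b Hb].
  { intro j; destruct (sS j) as [i ->]; exists i, []; now rewrite app_assoc. }
  assert (len : forall j, length (proj1_sig (s j)) = j + length p).
  { induction j as [|j IH]; [now rewrite s0|]; destruct (sS j) as [i ->].
    rewrite length_app, IH; simpl; lia. }
  assert (Hn : forall j, node b (length a0 + length p + j) = a0 ++ proj1_sig (s j)).
  { intro j; rewrite <- (Hb j (a0 ++ proj1_sig (s j)) []) by now rewrite app_nil_r.
    f_equal; rewrite length_app, len; lia. }
  assert (br : infinite_branch P b).
  { apply branch_marked; intro k; exists (length a0 + length p + k); split; [lia|].
    rewrite Hn; destruct (s k) as [q [Hq Rq]]; simpl.
    now apply invalid_marked, invalid_path_end. }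
  destruct (hr b br) as [N [_ [_ [[y cc] _]]]].
  destruct (cc (length a0 + length p)) as [k [Hk [_ [Ry _]]]].
  replace k with (length a0 + length p + (k - (length a0 + length p))) in Ry by lia.
  rewrite Hn in Ry.
  destruct (s (k - (length a0 + length p))) as [q [Hq Rq]]; simpl in Ry.
  apply NE; exists q; split; [|split]; auto; apply case_node_rule.
  - now apply invalid_marked, invalid_path_end.
  - now exists y.
Qed.

Lemma case_sequents_in L :
  exists (Y : list var) (Gs : list sequent),
    (forall G, In G Gs -> Forall (is_sigma n) G /\
       exists p y, invalid_path a0 p /\ mark P (a0 ++ p) = Some G /\
         In y Y /\ case_step y p) /\
    (forall p c, In c L -> invalid_path a0 p -> case_node (a0 ++ p) ->
       iso (a0 ++ p) c ->
       exists G, In G Gs /\ same_mark (mark P (a0 ++ p)) (Some G)).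
Proof.
  induction L as [|c L [Y [Gs [H1 H2]]]].
  - exists [], []; split; [easy|]; simpl; tauto.
  - destruct (classic (exists p, invalid_path a0 p /\ case_node (a0 ++ p) /\
      iso (a0 ++ p) c)) as [[p [Hp [Cp Ip]]]|NE].
    + destruct (case_node_sigma p Hp Cp) as [[G [E F]] [y Hy]].
      exists (y :: Y), (G :: Gs); split.
      * intros G' [<-|HG].
        { split; auto; exists p, y; simpl; auto. }
        { destruct (H1 G' HG) as [F' [p' [y' [A [B [C D]]]]]].
          split; auto; exists p', y'; simpl; auto. }
      * intros p' c' [<-|Hc] Hp' Cp' Ip'.
        { exists G; split; [now left|].
          assert (J : iso (a0 ++ p) (a0 ++ p'))
            by (apply iso_trans with c; auto; now apply iso_sym).
          destruct (iso_mark _ _ _ J E) as [G' [-> K]]; simpl.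
          now apply Permutation_sym. }
        { destruct (H2 p' c' Hc Hp' Cp' Ip') as [G' [HG' E']].
          exists G'; split; auto; now right. }
    + exists Y, Gs; split; auto; intros p' c' [<-|Hc] Hp' Cp' Ip'.
      * exfalso; apply NE; now exists p'.
      * now apply (H2 p' c').
Qed.

Lemma Sigma_not_refutes G :
  Forall (is_sigma n) G -> Sigma U n n (fun M rho => ~ refutes M rho G).
Proof.
  intro H; induction H as [|phi G H HG IH].
  - apply (Sigma_mono U n 0); [lia|].
    exists (Neq Zero Zero); split; [repeat constructor|].
    intros M HM rho; simpl; unfold refutes; rewrite Forall_nil_iff; tauto.
  - apply Sigma_equiv with (por (fun M rho => sat M rho phi) (fun M rho => ~ refutes M rho G)).
    + intros M HM rho; unfold por, refutes; rewrite Forall_cons_iff; tauto.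
    + apply Sigma_or; auto; now exists phi.
Qed.

Lemma Sigma_no_refutes Gs :
  (forall G, In G Gs -> Forall (is_sigma n) G) ->
  Sigma U n n (fun M rho => forall G, In G Gs -> ~ refutes M rho G).
Proof.
  induction Gs as [|G Gs IH]; intro H.
  - apply (Sigma_mono U n 0); [lia|].
    exists (Eq Zero Zero); split; [repeat constructor|].
    intros M HM rho; simpl; tauto.
  - apply Sigma_equiv with (pand (fun M rho => ~ refutes M rho G)
      (fun M rho => forall G, In G Gs -> ~ refutes M rho G)).
    + intros M HM rho; unfold pand; simpl; split.
      * intros [H1 H2] G' [<-|HG]; auto.
      * auto.
    + apply Sigma_and; [apply Sigma_not_refutes, H; now left|].
      apply IH; intros; apply H; now right.
Qed.

Lemma recurrent_contradiction : regular P -> False.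
Proof.
  intros [L HL]; destruct (case_sequents_in L) as [Y [Gs [H1 H2]]].
  assert (meet : forall M, model M -> forall rho p, invalid_path a0 p ->
    refuted M rho (a0 ++ p) -> exists G, In G Gs /\ refutes M rho G).
  { intros M HM rho p Hp R.
    destruct (refuted_case_node p M rho HM Hp R) as [q [Hq [Cq [G [E Rq]]]]].
    destruct (HL (a0 ++ q)) as [c [Hc Ic]].
    { now apply invalid_marked, invalid_path_end. }
    destruct (H2 q c Hc Hq Cq Ic) as [G' [HG' K]]; rewrite E in K; simpl in K.
    exists G'; split; auto; now apply (refutes_perm M rho G G'). }
  assert (V : forall M, model M -> forall rho G, In G Gs -> ~ refutes M rho G).
  { apply (progressive_IR U n HQ (nodup Nat.eq_dec Y)
      (fun M rho => forall G, In G Gs -> ~ refutes M rho G)).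
    - apply NoDup_nodup.
    - apply Sigma_no_refutes; intros G HG; now apply H1.
    (* Progressiveness by contraposition: the (case) step lowers one variable, and [meet] brings the
       refutation back to a sequent of [Gs] under the lowered assignment. *)
    - intros M HM rho K G HG R.
      destruct (H1 G HG) as [_ [p [y [Hp [E [Hy St]]]]]].
      destruct (St M HM rho) as [d [Ed Rd]]; [now exists G|].
      destruct (meet M HM (upd rho y d) (p ++ [1])) as [G' [HG' R']]; auto.
      { now apply (refuted_path p M (upd rho y d)). }
      apply (K y d) in R'; auto; [now apply nodup_In|].
      rewrite Ed; exists zero; now rewrite (add_succ_r U n HQ), (add_zero_r U n HQ). }
  pose proof (proj1 ha0) as I; apply invalid_refuted in I as [M [rho [HM R]]].
  destruct (meet M HM rho []) as [G [HG R']].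
  - split; [apply ha0|exact I].
  - now rewrite app_nil_r.
  - now apply (V M HM rho G).
Qed.

End Recurrent.

Lemma root_valid G : regular P -> same_mark (mark P []) (Some G) -> valid G.
Proof.
  intros hreg E M HM rho R.
  destruct (recurrent_exists [] hreg) as [a Ha].
  - apply invalid_refuted; exists M, rho; split; auto.
    destruct (same_mark_some _ _ _ (same_mark_sym _ _ E) eq_refl) as [G' [E' K]].
    exists G'; split; auto; now apply (refutes_perm M rho G G').
  - now apply (recurrent_contradiction a Ha).
Qed.

End Soundness.

Theorem theorem3 (n : nat) (T : formula -> Prop) (G : sequent)
    (hT : forall phi, T phi -> sentence phi)
    (hG : provable_S n T G) :
  theorem_IR (fun phi => Q_axiom phi \/ T phi) n (bigor G).
Proof.
  destruct hG as [P [[hb _] [hr [hreg hroot]]]].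
  apply completeness; [apply theorem_IR_closed|].
  intros M HM rho; apply sat_bigor.
  exact (root_valid n T P hb hr G hreg hroot M HM rho).
Qed.
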